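(* Regard $\mathbf D$ as a subalgebra of $\widehat{\dot{\mathbf D}}$ via the injective algebra homomorphism $\Phi:\mathbf D\to\widehat{\dot{\mathbf D}}$, $u\mapsto\sum_{\lambda\in\mathbb Z^n_\triangle}u1_\lambda$. Then $D\subseteq\widehat{\dot D}\cap\mathbf D$, and this inclusion is proper: $D\neq\widehat{\dot D}\cap\mathbf D$.
   Context: NOTATION. Fix an integer $n\ge 2$; $\mathbb N=\{0,1,2,\dots\}$; $\upsilon$ is an indeterminate; $\mathcal Z=\mathbb Z[\upsilon,\upsilon^{-1}]$. $\mathbb Z_\triangle^n$ is the set of integer sequences $\lambda=(\lambda_i)_{i\in\mathbb Z}$ with $\lambda_i=\lambda_{i-n}$ (identified with $\mathbb Z^n$ via $(\lambda_1,\dots,\lambda_n)$); $\mathbb N_\triangle^n$ is the subset with all entries $\ge 0$; addition and $\ge$ are componentwise; $e_i$ ($i$ mod $n$) is the $i$-th standard basis vector. Put $\lambda\cdot\mu=\sum_{i=1}^n\lambda_i\mu_i$ and $\langle\lambda,\mu\rangle=\sum_{i=1}^n\lambda_i\mu_i-\sum_{i=1}^n\lambda_i\mu_{i+1}$. $\Theta_\triangle(n)$ is the set of matrices $A=(a_{i,j})_{i,j\in\mathbb Z}$ with $a_{i,j}\in\mathbb N$, $a_{i,j}=a_{i+n,j+n}$, and finitely many nonzero entries in each row and column. $\Theta^+_\triangle(n)=\{A\in\Theta_\triangle(n): a_{i,j}=0\text{ for }i\ge j\}$. $E^\triangle_{i,j}\in\Theta_\triangle(n)$ has entries $1$ at positions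 $(i+sn,j+sn)$, $s\in\mathbb Z$, and $0$ elsewhere. For $\lambda\in\mathbb N^n_\triangle$ put $A_\lambda=\sum_{i=1}^n\lambda_iE^\triangle_{i,i+1}$. REPRESENTATIONS. Consider the cyclic quiver with vertex set $\mathbb Z/n\mathbb Z$ and arrows $i\to i+1$. Over a field $\mathbb F$, $S_i$ is the simple representation with $\mathbb F$ at vertex $i$ and $0$ elsewhere, $M^{i,j}$ ($i<j$) is the unique indecomposable representation of length $j-i$ with top $S_i$, and for $A\in\Theta_\triangle^+(n)$, $M_{\mathbb F}(A)=\bigoplus_{1\le i\le n,\,i<j}a_{i,j}M^{i,j}$. Its dimension vector is $\mathbf d(A)=(\sum_{s\le i<t}a_{s,t})_{i\in\mathbb Z}\in\mathbb N^n_\triangle$. For $A,B,C\in\Theta^+_\triangle(n)$ the Hall polynomial $\varphi^C_{A,B}\in\mathbb Z[\upsilon^2]$ satisfies: for every finite field $\mathbb F_q$, $\varphi^C_{A,B}|_{\upsilon^2=q}$ is the number of submodules $N\subseteq M_{\mathbb F_q}(C)$ with $N\cong M_{\mathbb F_q}(B)$ and $M_{\mathbb F_q}(C)/N\cong M_{\mathbb F_q}(A)$. THE DOUBLE RINGEL–HALL ALGEBRA $\mathbf D$ is the $\mathbb Q(\upsilon)$-algebra generated by $u_A^+,u_A^-$ ($A\in\Theta^+_\triangle(n)$) and $K_i^{\pm1}$ ($i\in\mathbb Z$) with relations (where $K^{\mathbf j}=K_1^{j_1}\cdots K_n^{j_n}$, $\tilde K_i=K_iK_{i+1}^{-1}$,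 $\tilde K^\nu=\tilde K_1^{\nu_1}\cdots\tilde K_n^{\nu_n}$): (1) $K_i=K_{i+n}$, $K_iK_j=K_jK_i$, $K_iK_i^{-1}=1$, $u_0^\pm=1$; (2) $K^{\mathbf j}u_A^+=\upsilon^{\langle\mathbf d(A),\mathbf j\rangle}u_A^+K^{\mathbf j}$, $u_A^-K^{\mathbf j}=\upsilon^{\langle\mathbf d(A),\mathbf j\rangle}K^{\mathbf j}u_A^-$; (3) $u_A^+u_B^+=\sum_C\upsilon^{\langle\mathbf d(A),\mathbf d(B)\rangle}\varphi^C_{A,B}u_C^+$; (4) $u_A^-u_B^-=\sum_C\upsilon^{\langle\mathbf d(B),\mathbf d(A)\rangle}\varphi^C_{B,A}u_C^-$; (5) for $\lambda,\mu\in\mathbb N^n_\triangle$, with both sums over $\alpha,\beta\in\mathbb N^n_\triangle$ such that $\lambda-\alpha=\mu-\beta\ge0$: $$\upsilon^{\langle\mu,\mu\rangle}\sum\kappa_{\lambda,\mu}^{\alpha,\beta}\upsilon^{\langle\beta,\lambda+\mu-\beta\rangle}\tilde K^{\mu-\beta}u^-_{A_\beta}u^+_{A_\alpha}=\upsilon^{\langle\mu,\lambda\rangle}\sum\kappa_{\lambda,\mu}^{\alpha,\beta}\upsilon^{\langle\mu-\beta,\alpha\rangle+\langle\mu,\beta\rangle}\tilde K^{\beta-\mu}u^+_{A_\alpha}u^-_{A_\beta},$$ $\kappa_{\lambda,\mu}^{\alpha,\beta}=\upsilon^{2\sum_{i=1}^n(\lambda_i-\alpha_i)(1-\alpha_i-\beta_i)}\prod_{1\le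 i\le n,\;0\le s\le\lambda_i-\alpha_i-1}(\upsilon^{2(\lambda_i-\alpha_i)}-\upsilon^{2s})^{-1}$. It is known that $\{u_A^+K^{\mathbf j}u_B^-\}$ ($A,B\in\Theta_\triangle^+(n)$, $\mathbf j\in\mathbb Z^n_\triangle$) is a $\mathbb Q(\upsilon)$-basis of $\mathbf D$. Put $\tilde u_A^\pm=\upsilon^{\dim\operatorname{End}(M(A))-\dim M(A)}u_A^\pm$. THE $\mathcal Z$-MODULE $D$. $D^\pm=\operatorname{span}_{\mathcal Z}\{\tilde u_A^\pm:A\in\Theta^+_\triangle(n)\}$; $D^0$ is the $\mathcal Z$-subalgebra of $\mathbf D$ generated by $K_i^{\pm1}$ and $\left[{K_i;0\atop t}\right]=\prod_{s=1}^t\frac{K_i\upsilon^{-s+1}-K_i^{-1}\upsilon^{s-1}}{\upsilon^s-\upsilon^{-s}}$ ($1\le i\le n$, $t>0$); $D=D^+D^0D^-\subseteq\mathbf D$ (the $\mathcal Z$-span of products). GRADING. Let $\alpha_i=e_i-e_{i+1}$ ($1\le i\le n$) and $\mathbb Z\Pi=\sum_i\mathbb Z\alpha_i\subseteq\mathbb Z^n_\triangle$. $\mathbf D=\bigoplus_{\nu\in\mathbb Z\Pi}\mathbf D_\nu$ is graded by $\deg u_A^+=\sum_{i=1}^nd_i\alpha_i$, $\deg u_A^-=-\sum_{i=1}^nd_i\alpha_i$ (where $\mathbf d(A)=(d_i)$), $\deg K_i^{\pm1}=0$. MODIFIED ALGEBRA. For $\lambda,\mu\in\mathbb Z^n_\triangle$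 let ${}_\lambda\mathbf D_\mu=\mathbf D/\big(\sum_{\mathbf j}(K^{\mathbf j}-\upsilon^{\lambda\cdot\mathbf j})\mathbf D+\sum_{\mathbf j}\mathbf D(K^{\mathbf j}-\upsilon^{\mu\cdot\mathbf j})\big)$ with canonical projection $\pi_{\lambda,\mu}$, and $\dot{\mathbf D}=\bigoplus_{\lambda,\mu}{}_\lambda\mathbf D_\mu$. One has $\pi_{\lambda,\mu}(\mathbf D_\nu)=0$ if $\nu\ne\lambda-\mu$. Product on $\dot{\mathbf D}$: for $t\in\mathbf D_{\lambda'-\mu'}$, $s\in\mathbf D_{\lambda''-\mu''}$, $\pi_{\lambda',\mu'}(t)\pi_{\lambda'',\mu''}(s)=\pi_{\lambda',\mu''}(ts)$ if $\mu'=\lambda''$ and $0$ otherwise. $\dot{\mathbf D}$ is a $\mathbf D$-bimodule via $t'\pi_{\lambda',\lambda''}(s)t''=\pi_{\lambda'+\nu',\lambda''-\nu''}(t'st'')$ for $t'\in\mathbf D_{\nu'}$, $t''\in\mathbf D_{\nu''}$, $s\in\mathbf D$. Put $1_\lambda=\pi_{\lambda,\lambda}(1)$; the elements $u_A^+1_\lambda u_B^-$ form a $\mathbb Q(\upsilon)$-basis of $\dot{\mathbf D}$. COMPLETION. $\widehat{\dot{\mathbf D}}$ is the $\mathbb Q(\upsilon)$-space of formal, possibly infinite, combinations $\sum_{A,B\in\Theta^+_\triangle(n),\,\lambda\in\mathbb Z^n_\triangle}\beta_{A,B,\lambda}u_A^+1_\lambda u_B^-$ ($\beta_{A,B,\lambda}\in\mathbb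 Q(\upsilon)$) such that for every $\mu\in\mathbb Z^n_\triangle$ the sets $\{(A,B,\lambda):\beta_{A,B,\lambda}\ne0,\ \lambda-\deg(u_B^-)=\mu\}$ and $\{(A,B,\lambda):\beta_{A,B,\lambda}\ne0,\ \lambda+\deg(u_A^+)=\mu\}$ are finite; product extended distributively from $\dot{\mathbf D}$. $\widehat{\dot D}$ is the set of elements of $\widehat{\dot{\mathbf D}}$ with all $\beta_{A,B,\lambda}\in\mathcal Z$. *)

(* Defs.v *)
From HB Require Import structures.
From mathcomp Require Import all_boot all_order all_algebra.
From mathcomp Require Import generic_quotient ring_quotient fraction.
From mathcomp Require Import all_classical.
From mathcomp Require Import monalg.

Set Implicit Arguments.
Unset Strict Implicit.
Unset Printing Implicit Defensive.

Import Order.TTheory GRing.Theory Num.Theory.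
Local Open Scope classical_set_scope.
Local Open Scope ring_scope.
Local Open Scope quotient_scope.
Local Open Scope card_scope.

(** * Subspaces, quotient spaces and quotient algebras *)

Record submod (F : fieldType) (V : lmodType F) :=
  Submod { scar :> V -> bool ; submodP : submod_closed scar }.

HB.instance Definition _ (F : fieldType) (V : lmodType F) (W : submod V) :=
  GRing.isSubmodClosed.Build F V (scar W) (submodP W).

Definition subsp (F : fieldType) (V : lmodType F) (W : submod V) :=
  {x : V | scar W x}.
HB.instance Definition _ (F : fieldType) (V : lmodType F) (W : submod V) :=
  SubChoice.on (subsp W).
HB.instance Definition _ (F : fieldType) (V : lmodType F) (W : submod V) :=
  [SubChoice_isSubLmodule of subsp W by <:].

Section LmodQuotient.
Variables (F : fieldType) (V : lmodType F) (W : submod V).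

Definition zscar : zmodClosed V := GRing.ZmodClosed.clone V (scar W) _.

Definition lquot := Quotient.quot zscar.
HB.instance Definition _ := GRing.Zmodule.on lquot.

Definition lpi (x : V) : lquot := \pi_(Quotient.quot zscar) x.
Definition lrep (x : lquot) : V := repr (x : Quotient.quot zscar).

Lemma lrepK x : lpi (lrep x) = x.
Proof. exact: reprK. Qed.

Lemma lpi_eq x y : lpi x = lpi y <-> scar W (x - y).
Proof.
rewrite /lpi; split=> [/eqP|h]; first by rewrite -Quotient.idealrBE.
by apply/eqP; rewrite -Quotient.idealrBE.
Qed.

Lemma lrep_pi x : scar W (lrep (lpi x) - x).
Proof. by apply/lpi_eq; rewrite lrepK. Qed.

Lemma lpi_zmod : zmod_morphism lpi.
Proof. by move=> x y; rewrite /lpi piE. Qed.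
HB.instance Definition _ := GRing.isZmodMorphism.Build V lquot lpi lpi_zmod.

Definition lscale (c : F) (x : lquot) : lquot := lpi (c *: lrep x).

Lemma lscale_pi c x : lscale c (lpi x) = lpi (c *: x).
Proof.
apply/lpi_eq; rewrite -scalerBr; have [W0 WP] := submodP W; rewrite -[_ *: _]addr0.
exact: (WP c _ _ (lrep_pi x) W0).
Qed.

Lemma lscaleA a b x : lscale a (lscale b x) = lscale (a * b) x.
Proof. by rewrite -[x]lrepK !lscale_pi scalerA. Qed.

Lemma lscale1 : left_id 1 lscale.
Proof. by move=> x; rewrite -[x]lrepK lscale_pi scale1r. Qed.

Lemma lscaleDr : right_distributive lscale +%R.
Proof.
move=> c x y; rewrite -[x]lrepK -[y]lrepK -raddfD !lscale_pi -raddfD.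
by rewrite scalerDr.
Qed.

Lemma lscaleDl x : {morph lscale^~ x : a b / a + b}.
Proof.
by move=> a b; rewrite -[x]lrepK !lscale_pi -raddfD scalerDl.
Qed.

HB.instance Definition _ := GRing.Zmodule_isLmodule.Build F lquot
  lscaleA lscale1 lscaleDr lscaleDl.

Lemma lpi_scalable : scalable lpi.
Proof. by move=> c x; rewrite -lscale_pi. Qed.
HB.instance Definition _ :=
  GRing.isScalable.Build F V lquot *:%R lpi lpi_scalable.

End LmodQuotient.

Definition span_closed (F : fieldType) (V : lmodType F) (R : set F)
    (W : set V) :=
  W 0 /\ forall c x y, R c -> W x -> W y -> W (c *: x + y).

(* The [R]-span of [S], for a subring [R] of the field [F]. *)
Definition span (F : fieldType) (V : lmodType F) (R : set F) (S : set V) :=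
  smallest (span_closed R) S.

Lemma span_submod (F : fieldType) (V : lmodType F) (S : set V) :
  submod_closed (fun x => `[< span setT S x >]).
Proof.
split=> [|c x y /asboolP hx /asboolP hy]; first by apply/asboolP => W [[W0 _] _].
apply/asboolP => W hW; have [[_ WP] _] := hW.
by apply: WP; [|exact: hx|exact: hy].
Qed.

Definition lspan (F : fieldType) (V : lmodType F) (S : set V) : submod V :=
  Submod (span_submod S).

Definition two_sided (F : fieldType) (A : lalgType F) (I : set A) :=
  [/\ I 0, (forall x y, I x -> I y -> I (x - y)) &
      (forall a x, I x -> I (a * x) /\ I (x * a))].

Section Presented.
Variables (F : fieldType) (A : lalgType F) (S : set A).

Definition ideal_gen : set A := smallest (@two_sided F A) S.

Lemma ideal_two_sided : two_sided ideal_gen.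
Proof.
split=> [W [[]]//|x y hx hy W hW|a x hx].
  by have [[_ WB _] _] := hW; apply: WB; [exact: hx|exact: hy].
by split=> W hW; have [[_ _ WM] _] := hW; case: (WM a x (hx W hW)).
Qed.

Lemma ideal_submod_closed : submod_closed (fun x => `[< ideal_gen x >]).
Proof.
have [I0 IB IM] := ideal_two_sided.
split=> [|c x y /asboolP hx /asboolP hy]; apply/asboolP => //.
have -> : c *: x + y = c%:A * x - (0 - y) by rewrite mulr_algl sub0r opprK.
by apply: (IB); [case: (IM c%:A x hx)|exact: (IB)].
Qed.

Definition ideal : submod A := Submod ideal_submod_closed.

Definition alg_quot := lquot ideal.
HB.instance Definition _ := GRing.Lmodule.on alg_quot.

Definition api (x : A) : alg_quot := lpi ideal x.
Lemma api_linear : linear api.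
Proof. exact: (linearP (lpi ideal)). Qed.
HB.instance Definition _ := GRing.isLinear.Build F A alg_quot *:%R api api_linear.

Definition aone : alg_quot := api 1.
Definition amul (x y : alg_quot) : alg_quot := api (lrep x * lrep y).

Lemma amul_pi x y : amul (api x) (api y) = api (x * y).
Proof.
have [I0 IB IM] := ideal_two_sided.
apply/lpi_eq/asboolP; set x' := lrep _; set y' := lrep _.
have -> : x' * y' - x * y = (x' - x) * y' - (x * - (y' - y)).
  by rewrite mulrN opprK mulrBl mulrBr addrA subrK.
have hx : ideal_gen (x' - x) by apply/asboolP; exact: (lrep_pi ideal x).
have hy : ideal_gen (y' - y) by apply/asboolP; exact: (lrep_pi ideal y).
apply: (IB); first by case: (IM y' _ hx).
by case: (IM x (- (y' - y))) => //; rewrite -sub0r; exact: (IB).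
Qed.

Lemma amulA : associative amul.
Proof.
move=> x y z; rewrite -[x]lrepK -[y]lrepK -[z]lrepK -!/(api _).
by rewrite !amul_pi mulrA.
Qed.

Lemma amul1x : left_id aone amul.
Proof. by move=> x; rewrite -[x]lrepK -/(api _) amul_pi mul1r. Qed.

Lemma amulx1 : right_id aone amul.
Proof. by move=> x; rewrite -[x]lrepK -/(api _) amul_pi mulr1. Qed.

Lemma amulDl : left_distributive amul +%R.
Proof.
move=> x y z; rewrite -[x]lrepK -[y]lrepK -[z]lrepK -!/(api _).
by rewrite -raddfD !amul_pi -raddfD mulrDl.
Qed.

Lemma amulDr : right_distributive amul +%R.
Proof.
move=> x y z; rewrite -[x]lrepK -[y]lrepK -[z]lrepK -!/(api _).
by rewrite -raddfD !amul_pi -raddfD mulrDr.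
Qed.

HB.instance Definition _ := GRing.Zmodule_isPzRing.Build alg_quot
  amulA amul1x amulx1 amulDl amulDr.

Lemma api_monoid : monoid_morphism api.
Proof. by split=> // x y; rewrite -amul_pi. Qed.
HB.instance Definition _ :=
  GRing.isMonoidMorphism.Build A alg_quot api api_monoid.

End Presented.

(** * Scalars and integer sequences *)

Definition Qv : fieldType := {fraction {poly rat}}.
Definition ups : Qv := tofrac ('X : {poly rat}).

(* Z[ups, ups^-1] inside Q(ups) *)
Definition Zv : set Qv :=
  [set x | exists (p : {poly int}) (m : nat),
     x = tofrac (map_poly intr p : {poly rat}) / ups ^+ m].

(* ['Z_n] is Z/n when [n >= 2], and then [res n i = i%:~R]. *)
Definition res (n : nat) (i : int) : 'Z_n := ((i %% n%:Z)%Z)%:~R.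

(* n-periodic integer sequences, as functions on Z/n; the entry of index
   [i : int] is the value at [res n i]. *)
Definition Zn (n : nat) := {ffun 'Z_n -> int}.
HB.instance Definition _ n := GRing.Zmodule.on (Zn n).

Section Sequences.
Variable n : nat.
Implicit Types l m : Zn n.

Definition nonneg l := forall i, 0 <= l i.
Definition dot l m : int := \sum_i l i * m i.
Definition euler l m : int := \sum_i l i * m i - \sum_i l i * m (i + 1).
Definition alpha (i : 'Z_n) : Zn n :=
  [ffun k => (k == i)%:R - (k == i + 1)%:R].

End Sequences.

(** * Periodic strictly upper triangular matrices *)

Record Thetap (n : nat) := MkThetap {
  entry :> int -> int -> nat;
  entry_per : forall i j, entry (i + n%:Z) (j + n%:Z) = entry i j;
  entry_row : forall i, finite_set [set j | entry i j != 0%N];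
  entry_col : forall j, finite_set [set i | entry i j != 0%N];
  entry_up : forall i j, j <= i -> entry i j = 0%N }.

HB.instance Definition _ n := gen_eqMixin (Thetap n).
HB.instance Definition _ n := gen_choiceMixin (Thetap n).

Section Matrices.
Variable n : nat.

Lemma finite0 : finite_set [set _ : int | 0%N != 0%N].
Proof. exact: sub_finite_set (finite_set0 _). Qed.

Definition Theta0 : Thetap n := @MkThetap n (fun _ _ => 0%N)
  (fun _ _ => erefl) (fun _ => finite0) (fun _ => finite0)
  (fun _ _ _ => erefl).

(* A_l = \sum_i l_i E_{i,i+1}, for l with nonnegative entries *)
Definition superdiag (l : Zn n) (i j : int) : nat :=
  if j == i + 1 then `|l (res n i)|%N else 0%N.

Lemma superdiag_row l i : finite_set [set j | superdiag l i j != 0%N].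
Proof.
apply: sub_finite_set (finite_set1 (i + 1)) => j /=.
by rewrite /superdiag; have [->|] := eqVneq j (i + 1).
Qed.

Lemma superdiag_col l j : finite_set [set i | superdiag l i j != 0%N].
Proof.
apply: sub_finite_set (finite_set1 (j - 1)) => i /=.
by rewrite /superdiag; have [-> _|] := eqVneq j (i + 1); rewrite ?addrK.
Qed.

Lemma superdiag_up l i j : j <= i -> superdiag l i j = 0%N.
Proof.
rewrite /superdiag; case: eqP => // -> le_ji.
by move: le_ji; rewrite gerDl ler10.
Qed.

Lemma superdiag_per l i j :
  superdiag l (i + n%:Z) (j + n%:Z) = superdiag l i j.
Proof. by rewrite /superdiag /res modzDr addrAC (inj_eq (addIr _)). Qed.

Definition Theta1 (l : Zn n) : Thetap n := MkThetap (superdiag_per l)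
  (superdiag_row l) (superdiag_col l) (@superdiag_up l).

(* The dimension vector; the infinite sum has finitely many nonzero terms. *)
Definition dimvec (A : Thetap n) : Zn n :=
  [ffun k : 'Z_n =>
     \sum_(st \in [set st : int * int | (st.1 <= k%:Z) && (k%:Z < st.2)])
        (entry A st.1 st.2)%:Z].

(* deg u_A^+ = - deg u_A^- *)
Definition degu (A : Thetap n) : Zn n := \sum_i alpha i *~ dimvec A i.

End Matrices.

(** * Representations of the cyclic quiver *)

Record qrep (n : nat) (F : fieldType) := QRep {
  qsp :> 'Z_n -> lmodType F;
  qarr : forall k, {linear qsp k -> qsp (k + 1)} }.

Section Representations.
Variables (n : nat) (F : fieldType).

Definition is_qhom (M N : qrep n F) (g : forall k, M k -> N k) :=
  (forall k, linear (g k)) /\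
  (forall k x, g (k + 1) (qarr M k x) = qarr N k (g k x)).

Definition qiso (M N : qrep n F) :=
  exists g : forall k, M k -> N k, is_qhom g /\ forall k, bijective (g k).

Record subqrep (M : qrep n F) := SubQRep {
  sub_sp :> forall k, submod (M k);
  sub_arr : forall k x, scar (sub_sp k) x -> scar (sub_sp (k + 1)) (qarr M k x) }.

Section SubQuotient.
Variables (M : qrep n F) (N : subqrep M).

Definition subq_map k (x : subsp (N k)) : subsp (N (k + 1)) :=
  Sub (qarr M k (val x)) (sub_arr (valP x)).

Lemma subq_map_linear k : linear (@subq_map k).
Proof. by move=> c x y; apply: val_inj; rewrite /= !linearP. Qed.
HB.instance Definition _ k :=
  GRing.isLinear.Build F _ _ *:%R (@subq_map k) (@subq_map_linear k).

Definition sub_rep : qrep n F :=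
  QRep (fun k => @subq_map k : {linear _ -> _}).

Definition quo_map k (x : lquot (N k)) : lquot (N (k + 1)) :=
  lpi (N (k + 1)) (qarr M k (lrep x)).

Lemma quo_map_pi k x : quo_map (lpi (N k) x) = lpi (N (k + 1)) (qarr M k x).
Proof.
by apply/lpi_eq; rewrite -linearB; apply: sub_arr; exact: lrep_pi.
Qed.

Lemma quo_map_linear k : linear (@quo_map k).
Proof.
move=> c x y; rewrite -[x]lrepK -[y]lrepK -linearP !quo_map_pi.
by rewrite !linearP.
Qed.
HB.instance Definition _ k :=
  GRing.isLinear.Build F _ _ *:%R (@quo_map k) (@quo_map_linear k).

Definition quo_rep : qrep n F :=
  QRep (fun k => @quo_map k : {linear _ -> _}).

End SubQuotient.

(* M(A) has one basis vector (i, j, c, s) for 1 <= i <= n, i < j, c < a_{i,j}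
   and i <= s < j: the basis vector at vertex s mod n of the c-th copy of
   M^{i,j}. The arrow at s maps (i, j, c, s) to (i, j, c, s + 1), or to 0 if
   s + 1 = j, so that the top of M^{i,j} is S_i. The basis being finite, the
   space at k is the space of all functions on the basis vectors at k. *)
Section SegmentModule.
Variable A : Thetap n.

Definition seg_at (k : 'Z_n) (x : int * int * nat * int) : bool :=
  let: (i, j, c, s) := x in
  [&& 1 <= i <= n%:Z, i < j, (c < entry A i j)%N, i <= s < j & res n s == k].

Definition seg (k : 'Z_n) := {x | seg_at k x}.

Definition seg_pred (x : int * int * nat * int) : int * int * nat * int :=
  let: (i, j, c, s) := x in (i, j, c, s - 1).

Definition seg_map k (f : seg k -> F^o) : seg (k + 1) -> F^o :=
  fun x => if insub (seg_pred (val x)) is Some y then f y else 0.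

Lemma seg_map_linear k : linear (@seg_map k).
Proof.
move=> c f g; apply/funext => x; rewrite /seg_map !fctE.
by case: insub => //; rewrite scaler0 addr0.
Qed.
HB.instance Definition _ k :=
  GRing.isLinear.Build F _ _ *:%R (@seg_map k) (@seg_map_linear k).

Definition modM : qrep n F :=
  QRep (fun k => @seg_map k : {linear _ -> _}).

End SegmentModule.

End Representations.

(** * Hall polynomials and the dimension of End(M(A)) *)

Section Hall.
Variable n : nat.
Implicit Types A B C : Thetap n.

(* [p], a polynomial in the variable ups^2, is the Hall polynomial of A, B, C *)
Definition is_hall A B C (p : {poly int}) :=
  forall F : finFieldType, exists m : nat,
    [set N : subqrep (modM F C) |
       qiso (sub_rep N) (modM F B) /\ qiso (quo_rep N) (modM F A)] #= `I_m /\
    p.[#|F|%:R] = m%:R.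

(* By a theorem of Ringel there is exactly one such polynomial, so that the
   default value 0 is never used. *)
Definition hall A B C : Qv :=
  (map_poly intr (xget 0 [set p | is_hall A B C p])).[ups ^+ 2].

Definition is_dim_End (F : fieldType) (M : qrep n F) (d : nat) :=
  exists b : 'I_d -> forall k, M k -> M k,
    (forall i, is_qhom (b i)) /\
    forall g : forall k, M k -> M k, is_qhom g ->
      exists! c : 'I_d -> F, forall k x, g k x = \sum_i c i *: b i k x.

(* This dimension does not depend on the ground field; we take rat. *)
Definition dim_End A : nat := xget 0%N [set d | is_dim_End (modM rat A) d].

Definition dim_M A : int := \sum_i dimvec A i.

End Hall.

(** * The double Ringel-Hall algebra *)

Section Monomials.
Variables (n : nat) (R : pzRingType) (K K' : int -> R).

Definition zpow (x x' : R) (z : int) : R :=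
  match z with Posz m => x ^+ m | Negz m => x' ^+ m.+1 end.

(* K^j = K_1^{j_1} ... K_n^{j_n}, where K' i is the inverse of K i *)
Definition Kmon (j : Zn n) : R :=
  \prod_(1 <= i < n.+1) zpow (K i) (K' i) (j (res n i)).

(* the same for \tilde K_i = K_i K_{i+1}^{-1} *)
Definition Ktmon (j : Zn n) : R :=
  \prod_(1 <= i < n.+1)
    zpow (K i * K' (i%:Z + 1)) (K (i%:Z + 1) * K' i) (j (res n i)).

End Monomials.

Inductive gen (n : nat) :=
  Gp of Thetap n | Gm of Thetap n | GK of int | GKV of int.

HB.instance Definition _ n := gen_eqMixin (gen n).
HB.instance Definition _ n := gen_choiceMixin (gen n).

Section DoubleRingelHall.
Variable n : nat.

Definition freeA := {malg Qv[{fmonom (gen n)}]}.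
HB.instance Definition _ := GRing.Lalgebra.on freeA.

Definition fgen (g : gen n) : freeA := << fmu g >>.
Local Notation fp A := (fgen (Gp A)).
Local Notation fm A := (fgen (Gm A)).
Local Notation fK i := (fgen (GK n i)).
Local Notation fKV i := (fgen (GKV n i)).
Local Notation fKmon := (Kmon (fun i => fK i) (fun i => fKV i)).
Local Notation fKtmon := (Ktmon (fun i => fK i) (fun i => fKV i)).

Definition kappa (l m a b : Zn n) : Qv :=
  ups ^ (2 * \sum_i (l i - a i) * (1 - a i - b i)) *
  \prod_i \prod_(s < `|l i - a i|%N) (ups ^ (2 * (l i - a i)) - ups ^ (2 * s%:Z))^-1.

Definition comm_range (l m : Zn n) : set (Zn n * Zn n) :=
  [set ab | [/\ nonneg ab.1, nonneg ab.2, l - ab.1 = m - ab.2 &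
                nonneg (l - ab.1)]].

(* The defining relations. Only finitely many C occur in the Hall products,
   and comm_range is finite. *)
Inductive drel : freeA -> freeA -> Prop :=
| drelK_per (i : int) : drel (fK (i + n%:Z)) (fK i)
| drelK_comm i j : drel (fK i * fK j) (fK j * fK i)
| drelKV i : drel (fK i * fKV i) 1
| drelVK i : drel (fKV i * fK i) 1
| drelp0 : drel (fp (Theta0 n)) 1
| drelm0 : drel (fm (Theta0 n)) 1
| drelKp j A :
    drel (fKmon j * fp A) (ups ^ euler (dimvec A) j *: (fp A * fKmon j))
| drelmK j A :
    drel (fm A * fKmon j) (ups ^ euler (dimvec A) j *: (fKmon j * fm A))
| drelpp A B :
    drel (fp A * fp B)
      (\sum_(C \in setT) (ups ^ euler (dimvec A) (dimvec B) * hall A B C) *: fp C)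
| drelmm A B :
    drel (fm A * fm B)
      (\sum_(C \in setT) (ups ^ euler (dimvec B) (dimvec A) * hall B A C) *: fm C)
| drelmp l m : nonneg l -> nonneg m ->
    drel
      (ups ^ euler m m *: \sum_(ab \in comm_range l m)
         (kappa l m ab.1 ab.2 * ups ^ euler ab.2 (l + m - ab.2)) *:
         (fKtmon (m - ab.2) * fm (Theta1 ab.2) * fp (Theta1 ab.1)))
      (ups ^ euler m l *: \sum_(ab \in comm_range l m)
         (kappa l m ab.1 ab.2 * ups ^ (euler (m - ab.2) ab.1 + euler m ab.2)) *:
         (fKtmon (ab.2 - m) * fp (Theta1 ab.1) * fm (Theta1 ab.2))).

Definition DRH :=
  alg_quot [set x : freeA | exists y z, drel y z /\ x = y - z].
HB.instance Definition _ := GRing.PzRing.on DRH.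
HB.instance Definition _ := GRing.Lmodule.on DRH.

Definition dgen (g : gen n) : DRH := api _ (fgen g).
Definition up A : DRH := dgen (Gp A).
Definition um A : DRH := dgen (Gm A).
Definition KD i : DRH := dgen (GK n i).
Definition KVD i : DRH := dgen (GKV n i).
Definition Kpow (j : Zn n) : DRH := Kmon KD KVD j.

(** * The Z-module D *)

Definition utp A : DRH := ups ^ ((dim_End A)%:Z - dim_M A) *: up A.
Definition utm A : DRH := ups ^ ((dim_End A)%:Z - dim_M A) *: um A.

(* [K_i; 0 / t] *)
Definition Kbinom (i : int) (t : nat) : DRH :=
  \prod_(1 <= s < t.+1)
    ((ups ^+ s - ups ^- s)^-1 *:
       (ups ^ (1 - s%:Z) *: KD i - ups ^ (s%:Z - 1) *: KVD i)).

Definition Zsubalg_closed (W : set DRH) :=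
  [/\ span_closed Zv W, W 1 & forall x y, W x -> W y -> W (x * y)].

Definition Dp : set DRH := span Zv (range utp).
Definition Dm : set DRH := span Zv (range utm).
Definition Dz : set DRH := smallest Zsubalg_closed
  [set x | exists i : int, 1 <= i <= n%:Z /\
     (x = KD i \/ x = KVD i \/ exists2 t, (0 < t)%N & x = Kbinom i t)].
Definition Dint : set DRH := span Zv
  [set x | exists a b c, [/\ Dp a, Dz b, Dm c & x = a * b * c]].

(** * The modified algebra and its completion *)

Definition Dlm_rel (l m : Zn n) : set DRH :=
  [set x | exists j y, x = (Kpow j - ups ^ dot l j *: (1 : DRH)) * y \/
                       x = y * (Kpow j - ups ^ dot m j *: (1 : DRH))].

(* the space {}_l D_m and the projection pi_{l,m} *)
Definition Dlm (l m : Zn n) := lquot (lspan (Dlm_rel l m)).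
HB.instance Definition _ l m := GRing.Lmodule.on (Dlm l m).
Definition pilm (l m : Zn n) : DRH -> Dlm l m := lpi (lspan (Dlm_rel l m)).

(* Elements of \dot D, and of its completion, are represented by the family
   of their components in the spaces {}_l D_m. *)
Definition dfam := forall l m : Zn n, Dlm l m.

(* pi_{l,m}(x), as an element of \dot D *)
Definition pi_at (l m : Zn n) (x : DRH) : dfam :=
  fun l' m' => if (l', m') == (l, m) then pilm l' m' x else 0.

(* u_A^+ 1_l u_B^- = pi_{l + deg u_A^+, l - deg u_B^-} (u_A^+ u_B^-) *)
Definition basis_elt A (l : Zn n) B : dfam :=
  pi_at (l + degu A) (l + degu B) (up A * um B).

(* u 1_m = \sum_nu pi_{m + nu, m} (u_nu), where u_nu is the component of u of
   degree nu. As pi_{l,m} kills D_nu for nu <> l - m, the component of u 1_m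
   in {}_l D_m is pi_{l,m}(u). *)
Definition mul_idem (u : DRH) (m : Zn n) : dfam :=
  fun l' m' => if m' == m then pilm l' m' u else 0.

Definition Phi (u : DRH) : dfam :=
  fun l' m' => \sum_(m \in setT) mul_idem u m l' m'.

(* Coefficients of a formal combination of the u_A^+ 1_l u_B^-, indexed by the
   triples (A, l, B). *)
Definition coefs := Thetap n * Zn n * Thetap n -> Qv.

Definition admissible (b : coefs) :=
  forall m : Zn n,
    finite_set [set t | b t != 0 /\ t.1.2 + degu t.2 = m] /\
    finite_set [set t | b t != 0 /\ t.1.2 + degu t.1.1 = m].

(* The components of the formal combination with coefficients [b]; they are
   finite sums when [b] is admissible. They determine [b], because the
   u_A^+ 1_l u_B^- form a basis of \dot D. *)
Definition combo (b : coefs) : dfam :=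
  fun l' m' => \sum_(t \in setT) b t *: basis_elt t.1.1 t.1.2 t.2 l' m'.

(* [Dhat setT] is the completion of \dot D, and [Dhat Zv] its integral form. *)
Definition Dhat (R : set Qv) : set dfam :=
  [set x | exists b, [/\ admissible b, (forall t, R (b t)) & x = combo b]].

End DoubleRingelHall.

(* Main.v *)
Require Import Defs.
From HB Require Import structures.
From mathcomp Require Import all_boot all_order all_algebra.
From mathcomp Require Import fraction.
From mathcomp Require Import all_classical.
From mathcomp Require Import monalg.
From mathcomp Require Import ring zify.

(** The element [(ups - 1)^-1 (K_1 - 1)] acts on [1_l] by the quantum integer
    [(ups^{l_1} - 1) / (ups - 1)], so it lies in the integral completion. To see
    that it is not in [D], use the characters [chi c] of the double Ringel-Hall
    algebra, for c <> 0 in Q(ups), which send every K_i to c and every u_A^+,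
    u_A^- with A <> 0 to 0. The values chi (ups^k) x factor through Phi, and
    chi c x is a Laurent polynomial in c; hence Phi x determines chi (-1) x. Now
    chi (-1) maps D into Z[ups, ups^-1], because it kills all [K_i; 0 / t] with
    t > 0, but it maps (ups - 1)^-1 (K_1 - 1) to -2 / (ups - 1). *)

Set Implicit Arguments.
Unset Strict Implicit.
Unset Printing Implicit Defensive.

Import Order.TTheory GRing.Theory Num.Theory.
Local Open Scope classical_set_scope.
Local Open Scope ring_scope.

(** * Scalars *)

Section QuantumIntegers.
Variables (F : fieldType) (q : F).

Lemma geometric_inv (m : nat) : q != 0 -> q - 1 != 0 ->
  (q - 1)^-1 * (q ^- m - 1) = - (q ^- m * ((q - 1)^-1 * (q ^+ m - 1))).
Proof.
move=> q0 q1; have U0 : q ^+ m != 0 by rewrite expf_neq0.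
by field; rewrite q1.
Qed.

(** The quantum integer of k times q - q^-1; that factor cancels in the quotients below. *)
Definition qbr (k : int) : F := q ^ k - q ^ (- k).

Lemma qbrD (k m : int) : q != 0 ->
  qbr (k + m) = q ^ m * qbr k + q ^ (- k) * qbr m.
Proof.
move=> q0; rewrite /qbr !mulrBr -!expfzDr // opprD addrA.
by rewrite [m + k]addrC [m - k]addrC subrK.
Qed.

(** The Gaussian binomial coefficient with any integer k on top. For q = [ups] it is the scalar by
    which [Kbinom] acts on a weight with entry k. *)
Definition gauss (k : int) (t : nat) : F :=
  \prod_(1 <= s < t.+1) (qbr (k + 1 - s%:Z) / qbr s).

Lemma gaussS k t : gauss k t.+1 = gauss k t * (qbr (k - t%:Z) / qbr t.+1).
Proof.
rewrite /gauss big_nat_recr //=; congr (_ * (qbr _ / _)).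
by rewrite intS opprD addrA addrK.
Qed.

(** Raising k and t together keeps all brackets of the numerator and puts a new one, that of k + 1,
    on top. *)
Lemma gauss_shift k t :
  gauss (k + 1) t.+1 = gauss k t * (qbr (k + 1) / qbr t.+1).
Proof.
elim: t => [|t IH].
  by rewrite /gauss big_nat1 big_geq // mul1r addrK.
rewrite gaussS IH [gauss k t.+1]gaussS intS opprD addrA addrK.
by rewrite -!mulrA; congr (_ * _); ring.
Qed.

(** The q-Pascal rule. Taking out [gauss q k t] on both sides leaves the splitting of the bracket of
    k + 1 = (k - t) + (t + 1). *)
Lemma gauss_pascal k t : q != 0 -> qbr t.+1 != 0 ->
  gauss (k + 1) t.+1 =
    q ^ t.+1%:Z * gauss k t.+1 + q ^ (t%:Z - k) * gauss k t.
Proof.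
move=> q0 qt; rewrite gauss_shift gaussS.
have -> : k + 1 = k - t%:Z + t.+1%:Z by rewrite intS addrCA subrK addrC.
rewrite (qbrD (k - t%:Z)) // opprB; field; exact: qt.
Qed.

End QuantumIntegers.

(** * Laurent polynomials and integrality of quantum integers and Gaussian binomials *)

Lemma ups_neq0 : ups != 0.
Proof. by rewrite /ups tofrac_eq0 polyX_eq0. Qed.

Lemma expr_ups_inj : injective (fun k : nat => ups ^+ k).
Proof.
move=> i j /= /eqP; rewrite -!tofracXn tofrac_eq => /eqP /(congr1 (size \o polyseq)).
by rewrite /= !size_polyXn => -[].
Qed.

Lemma exprz_ups_inj : injective (fun k : int => ups ^ k).
Proof.
suff ups_eq1 (k : int) : ups ^ k = 1 -> k = 0.
  move=> i j /= ij; apply/eqP; rewrite -subr_eq0; apply/eqP/ups_eq1.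
  by rewrite expfzDr ?ups_neq0 // ij -expfzDr ?ups_neq0 // subrr expr0z.
have pos (m : nat) : ups ^+ m = 1 -> m = 0%N.
  by rewrite -(expr0 ups) => /expr_ups_inj.
case: k => m; first by move=> /pos ->.
by move=> /(congr1 GRing.inv); rewrite [ups ^ _]/(ups ^- m.+1) invrK invr1 => /pos.
Qed.

Lemma Zv_poly (p : {poly int}) : Zv (tofrac (map_poly intr p : {poly rat})).
Proof. by exists p, 0%N; rewrite expr0 divr1. Qed.

Lemma Zv0 : Zv 0.
Proof. by have := Zv_poly 0; rewrite rmorph0 tofrac0. Qed.

Lemma Zv1 : Zv 1.
Proof. by have := Zv_poly 1; rewrite rmorph1 tofrac1. Qed.

Lemma ZvM x y : Zv x -> Zv y -> Zv (x * y).
Proof.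
move=> [p [i ->]] [q [j ->]]; exists (p * q), (i + j)%N.
by rewrite rmorphM tofracM mulf_div exprD.
Qed.

Lemma ZvD x y : Zv x -> Zv y -> Zv (x + y).
Proof.
move=> [p [i ->]] [q [j ->]]; exists (p * 'X^j + q * 'X^i), (i + j)%N.
rewrite rmorphD !rmorphM /= !map_polyXn tofracD !tofracM !tofracXn exprD.
by rewrite addf_div ?expf_neq0 ?ups_neq0.
Qed.

Lemma ZvN x : Zv x -> Zv (- x).
Proof. by move=> [p [i ->]]; exists (- p), i; rewrite rmorphN tofracN mulNr. Qed.

Lemma ZvB x y : Zv x -> Zv y -> Zv (x - y).
Proof. by move=> ? ?; apply/ZvD/ZvN. Qed.

Lemma Zv_ups (k : int) : Zv (ups ^ k).
Proof.
case: k => m; last by exists 1, m.+1; rewrite rmorph1 tofrac1 div1r.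
by have := Zv_poly 'X^m; rewrite map_polyXn tofracXn.
Qed.

(** Clearing the powers of [ups] leaves a polynomial identity with a factor X - 1 on one side;
    evaluate it at 1. *)
Lemma Zv_eval1 (p : {poly int}) (m : nat) (x : Qv) :
  x * (ups - 1) = tofrac (map_poly intr p : {poly rat}) / ups ^+ m ->
  Zv x -> p.[1] = 0.
Proof.
move=> xp [q [k xq]]; move: xp; rewrite {}xq.
have e1 : ups - 1 = tofrac ('X - 1 : {poly rat}) by rewrite tofracB tofrac1.
rewrite e1 mulrAC -tofracM => /eqP; rewrite eqr_div ?expf_neq0 ?ups_neq0 //.
rewrite -!tofracXn -!tofracM tofrac_eq => /eqP /(congr1 (fun p => p.[1])).
rewrite !hornerE expr1n mulr1 => /esym /eqP.
have -> : 1 = intr 1 :> rat by [].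
by rewrite horner_map /= intr_eq0 => /eqP.
Qed.

Lemma not_Zv_witness : ~ Zv ((ups - 1)^-1 * (-1 - 1)).
Proof.
have u1 : ups - 1 != 0.
  rewrite subr_eq0; apply/eqP; rewrite -[X in X = _]expr1 -(expr0 ups).
  by move=> /expr_ups_inj.
move=> /(@Zv_eval1 (-1 - 1)%:P 0).
rewrite hornerC => H; suff /H : (ups - 1)^-1 * (-1 - 1) * (ups - 1) =
  tofrac (map_poly intr (-1 - 1)%:P : {poly rat}) / ups ^+ 0 by [].
rewrite mulrAC mulVf // mul1r expr0 divr1 map_polyC /=.
rewrite (_ : (-1 - 1)%:~R = -1 - 1 :> rat) //.
by rewrite polyCB polyCN polyC1 tofracB tofracN tofrac1.
Qed.

(** A geometric sum for k >= 0; a negative k reduces to -k by taking out a power of [ups]. *)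
Lemma Zv_geometric (k : int) : Zv ((ups - 1)^-1 * (ups ^ k - 1)).
Proof.
have u1 : ups - 1 != 0.
  rewrite subr_eq0; apply/eqP; rewrite -[X in X = _]expr1 -(expr0 ups).
  by move=> /expr_ups_inj.
have pos (m : nat) : Zv ((ups - 1)^-1 * (ups ^+ m - 1)).
  rewrite subrX1 mulrA mulVf // mul1r.
  by elim/big_ind: _ => [|? ? ? ?|i _]; [exact: Zv0|exact: ZvD|exact: (Zv_ups i)].
have u0 := ups_neq0; case: k => m; first exact: pos.
have -> : (ups - 1)^-1 * (ups ^ Negz m - 1) =
    - (ups ^ Negz m * ((ups - 1)^-1 * (ups ^+ m.+1 - 1))).
  exact: geometric_inv.
by apply: ZvN; apply: ZvM; [exact: Zv_ups|exact: pos].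
Qed.

Lemma qbr_neq0 (k : int) : k != 0 -> qbr ups k != 0.
Proof.
by move=> k0; rewrite subr_eq0; apply/eqP => /exprz_ups_inj; lia.
Qed.

(** Induction on t, and inside it on k in both directions from k = 0, where the coefficient vanishes
    for t > 0. *)
Lemma Zv_gauss k t : Zv (gauss ups k t).
Proof.
elim: t k => [|t IH] k; first by rewrite /gauss big_geq //; exact: Zv1.
have pascalZ i : Zv (ups ^ (t%:Z - i) * gauss ups i t).
  by apply: ZvM; [exact: Zv_ups|exact: IH].
have gauss0 : Zv (gauss ups 0 t.+1).
  by rewrite /gauss big_nat_recl //= addrN /qbr oppr0 subrr !mul0r; exact: Zv0.
have step i : gauss ups (i + 1) t.+1 =
    ups ^ t.+1%:Z * gauss ups i t.+1 + ups ^ (t%:Z - i) * gauss ups i t.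
  by apply: gauss_pascal ups_neq0 _; exact: qbr_neq0.
elim/int_rec: k => [//|m IHm|m IHm].
  have -> : m.+1%:Z = m%:Z + 1 by lia.
  rewrite step; apply: ZvD (pascalZ _).
  by apply: ZvM IHm; exact: Zv_ups.
(* Downwards, the Pascal rule is solved for its first term, whose coefficient is a unit of [Zv]. *)
have -> : gauss ups (- m.+1%:Z) t.+1 = ups ^ (- t.+1%:Z) *
    (gauss ups (- m%:Z) t.+1 - ups ^ (t%:Z - - m.+1%:Z) * gauss ups (- m.+1%:Z) t).
  have mE : - m%:Z = - m.+1%:Z + 1 by lia.
  rewrite [in RHS]mE step addrK mulrA -expfzDr ?ups_neq0 // addNr expr0z.
  by rewrite mul1r.
by apply: ZvM; [exact: Zv_ups|exact: ZvB].
Qed.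

(** * Trivial representations and Hall numbers *)

Section TrivialModules.
Variable n : nat.
Implicit Types A B C : Thetap n.

Lemma Thetap_ext A B : (forall i j, entry A i j = entry B i j) -> A = B.
Proof.
case: A B => [a a1 a2 a3 a4] [b b1 b2 b3 b4] /= ab.
have {}ab : a = b by apply/funext => i; apply/funext => j; exact: ab.
by subst b; congr MkThetap; exact: Prop_irrelevance.
Qed.

Lemma entry_shift A (m i j : int) :
  entry A (i + m * n%:Z) (j + m * n%:Z) = entry A i j.
Proof.
have step k : entry A (i + (k + 1) * n%:Z) (j + (k + 1) * n%:Z) =
    entry A (i + k * n%:Z) (j + k * n%:Z).
  by rewrite !mulrDl !mul1r !addrA entry_per.
elim/int_rec: m => [|m IH|m IH]; first by rewrite !mul0r !addr0.
  by rewrite (_ : m.+1%:Z = m%:Z + 1) ?step //; lia.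
by rewrite -step -[RHS]IH (_ : - m.+1%:Z + 1 = - m%:Z) //; lia.
Qed.

(** The characters only distinguish zero from nonzero modules, so the Hall numbers that matter are
    those in which zero modules force the count. *)
Definition trivial_rep (F : fieldType) (M : qrep n F) :=
  forall k (x : M k), x = 0.

Lemma trivial_modM (F : fieldType) A : (1 < n)%N ->
  trivial_rep (modM F A) <-> A = Theta0 n.
Proof.
move=> n_gt1; split=> [triv|->]; last first.
  move=> k f; apply/funext => -[[[[i j] c] s] cs]; exfalso.
  by case/and5P: cs.
apply: Thetap_ext => i j; apply/eqP; apply: contraT => Aij; exfalso.
(* The basis of M(A) uses rows 1 to n only, so the nonzero entry is moved along its diagonal to the
   row i' in that range; the constant function 1 is then a nonzero vector. *)
pose i' := ((i - 1) %% n%:Z)%Z + 1; pose m := - ((i - 1) %/ n%:Z)%Z.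
have n0 : n%:Z != 0 by lia.
have i'E : i' = i + m * n%:Z.
  by rewrite /i' /m; have := divz_eq (i - 1) n%:Z; lia.
have i'_ge1 : 1 <= i' by have := modz_ge0 (i - 1) n0; lia.
have i'_len : i' <= n%:Z by have := @ltz_pmod (i - 1) n%:Z; lia.
have lt_ij : i < j.
  by rewrite ltNge; apply: contra Aij => /(entry_up A) ->.
pose j' := j + m * n%:Z.
have x_at : seg_at A (res n i') (i', j', 0%N, i').
  rewrite /seg_at /= i'_ge1 i'_len lexx eqxx i'E ltrD2r lt_ij entry_shift.
  by rewrite lt0n Aij.
pose x : seg A (res n i') := Sub _ x_at.
have one_eq0 : (fun=> 1 : F^o) x = (0 : modM F A (res n i')) x.
  by rewrite -[0](triv _ (fun=> 1 : F^o)).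
by have /eqP := one_eq0; rewrite oner_eq0.
Qed.

Section Isomorphisms.
Variable F : fieldType.
Implicit Types M N : qrep n F.

Lemma trivial_qiso M N : trivial_rep M -> trivial_rep N -> qiso M N.
Proof.
move=> M0 N0; exists (fun k _ => 0); split.
  by split=> [k c x y|k x]; [rewrite scaler0 addr0|rewrite linear0].
by move=> k; exists (fun _ => 0) => x; rewrite ?(M0 k x) ?(N0 k x).
Qed.

Lemma qiso_trivialr M N : qiso M N -> trivial_rep M -> trivial_rep N.
Proof.
move=> [g [[glin _] gbij]] M0 k x; have [h hK gK] := gbij k.
pose gL := HB.pack_for {linear M k -> N k} (g k)
  (GRing.isLinear.Build _ _ _ _ _ (glin k)).
by rewrite -[x]gK [h x]M0 -[g k]/(gL : _ -> _) linear0.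
Qed.

Lemma qiso_triviall M N : qiso M N -> trivial_rep N -> trivial_rep M.
Proof.
move=> [g [_ gbij]] N0 k x; apply: (bij_inj (gbij k)).
by rewrite [LHS]N0 [RHS]N0.
Qed.

Lemma trivial_sub_rep M (N : subqrep M) : trivial_rep M -> trivial_rep (sub_rep N).
Proof. by move=> M0 k x; apply: val_inj; rewrite [LHS]M0 [RHS]M0. Qed.

Lemma trivial_quo_rep M (N : subqrep M) : trivial_rep M -> trivial_rep (quo_rep N).
Proof. by move=> M0 k x; rewrite -[x]lrepK [lrep x]M0 linear0. Qed.

Lemma trivial_extension M (N : subqrep M) :
  trivial_rep (sub_rep N) -> trivial_rep (quo_rep N) -> trivial_rep M.
Proof.
move=> N0 Q0 k x; have : lpi (N k) x = lpi (N k) 0 by rewrite [LHS]Q0 linear0.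
move/lpi_eq; rewrite subr0 => Nx.
by have /(congr1 val) := N0 k (Sub x Nx).
Qed.

(** Each membership predicate contains 0 and is therefore constantly true; the records then agree by
    proof irrelevance. *)
Lemma trivial_subqrep_eq M (N N' : subqrep M) : trivial_rep M -> N = N'.
Proof.
move=> M0.
have sc (W : subqrep M) k x : scar (W k) x = true.
  by rewrite [x]M0; have [W0 _] := submodP (W k).
case: N N' (sc N) (sc N') => [s a] [s' a'] /= s1 s1'.
have ss' : s = s'.
  apply/functional_extensionality_dep => k.
  case: (s k) (s' k) (s1 k) (s1' k) => [f fP] [f' fP'] /= f1 f1'.
  have ff' : f = f' by apply/funext => x; rewrite f1 f1'.
  by subst f'; congr Submod; exact: Prop_irrelevance.
by subst s'; congr SubQRep; exact: Prop_irrelevance.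
Qed.

Lemma trivial_subqrep_exists M : trivial_rep M -> exists N : subqrep M, True.
Proof.
move=> M0; have sc k : submod_closed (fun _ : M k => true) by [].
by exists (@SubQRep _ _ M (fun k => Submod (sc k)) (fun k x _ => isT)).
Qed.

End Isomorphisms.

(** * Uniqueness of Hall polynomials and their values at zero modules *)

Lemma poly_int_eqP (p r : {poly int}) :
  (forall l, prime l -> p.[l%:R] = r.[l%:R]) -> p = r.
Proof.
move=> pr; apply/eqP; rewrite -subr_eq0; apply: contraT => d0.
(* As many distinct primes as the size of the difference are more roots than it can have. *)
have primes_unbounded m : exists s : seq nat, [/\ all prime s, uniq s & size s = m].
  elim: m => [|m [s [ps us ss]]]; first by exists [::].
  have [l l_gt pl] := prime_above (\max_(i <- s) i).
  exists (l :: s); split; rewrite /= ?pl ?ss // us andbT.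
  apply/negP => ls; have := @leq_bigmax_seq _ s xpredT id l ls isT.
  by rewrite leqNgt l_gt.
have [s [ps us ss]] := primes_unbounded (size (p - r)).
have := max_poly_roots d0 (rs := [seq l%:R | l <- s]).
rewrite size_map ss ltnn map_inj_uniq // => [H|]; last by move=> x y /=; lia.
apply: H => //; apply/allP => _ /mapP[l ls ->].
by rewrite rootE hornerD hornerN pr ?subrr //; exact: (allP ps).
Qed.

(** The counts over the prime fields fix the values at all primes. Hence the choice made in [hall]
    returns any polynomial known to count correctly. *)
Lemma is_hall_uniq A B C (p r : {poly int}) :
  is_hall A B C p -> is_hall A B C r -> p = r.
Proof.
move=> Hp Hr; apply: poly_int_eqP => l pl.
have [m [cm em]] := Hp 'F_l; have [m' [cm' em']] := Hr 'F_l.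
rewrite card_Fp // in em em'; rewrite em em'.
suff -> : m = m' by [].
by apply/card_eq_II; apply: card_eq_trans cm'; rewrite card_eq_sym.
Qed.

Lemma hall_eq A B C (p : {poly int}) :
  is_hall A B C p -> hall A B C = (map_poly intr p).[ups ^+ 2].
Proof.
move=> Hp; rewrite /hall (xget_unique 0 Hp) // => r Hr.
exact: is_hall_uniq Hr Hp.
Qed.

Hypothesis n_gt1 : (1 < n)%N.

(** The middle term of a short exact sequence is zero exactly when both ends are; otherwise there is
    nothing to count, over any field. *)
Lemma hall_trivial_neq A B C :
  ~ (A = Theta0 n /\ B = Theta0 n <-> C = Theta0 n) -> hall A B C = 0.
Proof.
move=> ABC; rewrite (@hall_eq _ _ _ 0) ?rmorph0 ?horner0 // => F.
exists 0%N; rewrite horner0; split=> //.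
rewrite II0 card_eq0; apply/eqP; rewrite -subset0 => N /= [NB NA]; apply: ABC.
split=> [[A0 B0]|C0].
  apply/(trivial_modM F _ n_gt1); apply: (@trivial_extension F _ N).
    by apply: qiso_triviall NB _; apply/trivial_modM.
  by apply: qiso_triviall NA _; apply/trivial_modM.
have M0 : trivial_rep (modM F C) by apply/trivial_modM.
by split; apply/(trivial_modM F _ n_gt1);
  [apply: qiso_trivialr NA (trivial_quo_rep M0)|
   apply: qiso_trivialr NB (trivial_sub_rep M0)].
Qed.

Lemma hall0 : hall (Theta0 n) (Theta0 n) (Theta0 n) = 1.
Proof.
rewrite (@hall_eq _ _ _ 1) ?rmorph1 ?hornerC // => F; exists 1%N.
rewrite hornerC; split=> //.
have M0 : trivial_rep (modM F (Theta0 n)) by apply/trivial_modM.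
have [N _] := trivial_subqrep_exists M0.
apply: card_eq_trans (@card_set1 _ N).
rewrite (_ : [set _ | _] = [set N]) ?card_eqxx //.
apply/seteqP; split=> [N' _|_ ->] /=; first exact: trivial_subqrep_eq.
split; first exact: trivial_qiso (trivial_sub_rep M0) M0.
exact: trivial_qiso (trivial_quo_rep M0) M0.
Qed.

End TrivialModules.

(** * The characters on the free algebra *)

Lemma zpowE (F : fieldType) (c : F) (z : int) : zpow c c^-1 z = c ^ z.
Proof. by case: z => m //=; rewrite exprVn. Qed.

Lemma Kmon_morph (n : nat) (R S : pzRingType) (f : {rmorphism R -> S})
    (K K' : int -> R) (j : Zn n) :
  f (Kmon K K' j) = Kmon (f \o K) (f \o K') j.
Proof.
rewrite /Kmon rmorph_prod; apply: eq_bigr => i _.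
by case: (j _) => m /=; rewrite rmorphXn.
Qed.

Lemma Ktmon_morph (n : nat) (R S : pzRingType) (f : {rmorphism R -> S})
    (K K' : int -> R) (j : Zn n) :
  f (Ktmon K K' j) = Ktmon (f \o K) (f \o K') j.
Proof.
rewrite /Ktmon rmorph_prod; apply: eq_bigr => i _.
by case: (j _) => m /=; rewrite rmorphXn rmorphM.
Qed.

Section Characters.
Variable n : nat.
Implicit Types A B C : Thetap n.

(** Giving all K_i the same value sends every product of the K_i K_{i+1}^-1 to 1, which lets both
    sides of [drelmp] agree. *)
Definition chi_gen (c : Qv) (g : gen n) : Qv :=
  match g with
  | Gp A | Gm A => (A == Theta0 n)%:R
  | GK _ => c
  | GKV _ => c^-1
  end.

Definition chi_mon (c : Qv) (w : {fmonom (gen n)}) : Qv :=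
  \prod_(g <- (w : seq (gen n))) chi_gen c g.

Lemma chi_mon_mmorphism c : mmorphism (chi_mon c).
Proof.
by split=> [v w|]; rewrite /chi_mon ?fmM ?big_cat ?fm1 ?big_nil.
Qed.
HB.instance Definition _ c :=
  isMultiplicative.Build _ Qv (chi_mon c) (chi_mon_mmorphism c).

Definition chi_free (c : Qv) : freeA n -> Qv := mmap idfun (chi_mon c).
HB.instance Definition _ c := GRing.RMorphism.on (chi_free c).

Lemma chi_freeZ c a (x : freeA n) : chi_free c (a *: x) = a * chi_free c x.
Proof. exact: mmapZ. Qed.

Lemma chi_free_gen c g : chi_free c (fgen g) = chi_gen c g.
Proof. by rewrite /chi_free mmapU /= mul1r /chi_mon fmU big_seq1. Qed.

Lemma chi_freeM c (x y : freeA n) : chi_free c (x * y) = chi_free c x * chi_free c y.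
Proof. exact: rmorphM. Qed.

Lemma chi_free1 c : chi_free c (1 : freeA n) = 1.
Proof. exact: rmorph1. Qed.

(** * Dependence of the characters on c *)

Definition laurent_fun (f : Qv -> Qv) :=
  exists (p : {poly Qv}) (m : nat), forall c, c != 0 -> f c = p.[c] / c ^+ m.

(** On generators the value is a constant, c or c^-1, and Laurent polynomials are closed under sums
    and products. *)
Lemma laurent_chi_free (x : freeA n) : laurent_fun (chi_free^~ x).
Proof.
have const a : laurent_fun (fun=> a).
  by exists a%:P, 0%N => c _; rewrite hornerC expr0 divr1.
have add f g : laurent_fun f -> laurent_fun g -> laurent_fun (fun c => f c + g c).
  move=> [p [i pf]] [r [j rg]]; exists (p * 'X^j + r * 'X^i), (i + j)%N => c c0.
  rewrite pf // rg // addf_div ?expf_neq0 // hornerD !hornerM !hornerXn.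
  by rewrite exprD.
have mul f g : laurent_fun f -> laurent_fun g -> laurent_fun (fun c => f c * g c).
  move=> [p [i pf]] [r [j rg]]; exists (p * r), (i + j)%N => c c0.
  by rewrite pf // rg // hornerM mulf_div exprD.
have genL g : laurent_fun (chi_gen^~ g).
  case: g => [A|A|i|i]; rewrite /chi_gen; try exact: const.
    by exists 'X, 0%N => c _; rewrite hornerX expr0 divr1.
  by exists 1, 1%N => c _; rewrite hornerC expr1 div1r.
have mon (w : seq (gen n)) : laurent_fun (fun c => \prod_(g <- w) chi_gen c g).
  elim: w => [|g w IH].
    by have [p [m H]] := const 1; exists p, m => c c0; rewrite big_nil -H.
  have [p [m H]] := mul _ _ (genL g) IH.
  by exists p, m => c c0; rewrite big_cons -H.
(* For s the support of x, this sum is [chi_free c x] by definition. *)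
have sum (s : seq {fmonom (gen n)}) :
    laurent_fun (fun c => \sum_(w <- s) mcoeff w x * chi_mon c w).
  elim: s => [|w s IH].
    by have [p [m H]] := const 0; exists p, m => c c0; rewrite big_nil -H.
  have [p [m H]] := add _ _ (mul _ _ (const (mcoeff w x)) (mon w)) IH.
  by exists p, m => c c0; rewrite big_cons -H.
exact: sum.
Qed.

Lemma laurent_fun_eq (f g : Qv -> Qv) :
  laurent_fun f -> laurent_fun g -> (forall m : nat, f (ups ^+ m) = g (ups ^+ m)) ->
  forall c, c != 0 -> f c = g c.
Proof.
move=> [p [i pf]] [r [j rg]] fg c c0.
(* After cross-multiplication this is an identity of polynomials; a nonzero difference d would have
   [size d] distinct roots among the powers of [ups]. *)
suff pr : p * 'X^j = r * 'X^i.
  rewrite pf // rg //; apply/eqP; rewrite eqr_div ?expf_neq0 //.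
  by have := congr1 (horner^~ c) pr; rewrite !hornerM !hornerXn => ->.
apply/eqP; rewrite -subr_eq0; apply: contraT => d0.
set d := _ - _ in d0.
have := max_poly_roots d0 (rs := [seq ups ^+ m | m <- iota 0 (size d)]).
rewrite size_map size_iota ltnn map_inj_uniq ?iota_uniq; last exact: expr_ups_inj.
move=> H; apply: H => //; apply/allP => _ /mapP[m _ ->].
have um : ups ^+ m != 0 by rewrite expf_neq0 ?ups_neq0.
rewrite rootE hornerD hornerN !hornerM !hornerXn subr_eq0.
move: (ups ^+ m) um (fg m) => {d d0 c0} u u0.
by rewrite (pf u u0) (rg u u0) => /eqP; rewrite eqr_div ?expf_neq0.
Qed.

(** * Auxiliary facts for the defining relations *)

Lemma dimvec0 : dimvec (Theta0 n) = 0.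
Proof. by apply/ffunP => k; rewrite !ffunE fsbig1. Qed.

Lemma euler0l (l : Zn n) : euler 0 l = 0.
Proof. by rewrite /euler !big1 ?subr0 // => i _; rewrite ffunE mul0r. Qed.

Lemma euler0r (l : Zn n) : euler l 0 = 0.
Proof. by rewrite /euler !big1 ?subr0 // => i _; rewrite ffunE mulr0. Qed.

Lemma comm_range_finite (l m : Zn n) : finite_set (comm_range l m).
Proof.
pose N := (\max_i `|l i|)%N.
(* The first component is bounded entrywise by l, and it determines the second, so [f] covers the
   whole range. *)
pose f (a : {ffun 'Z_n -> 'I_N.+1}) : Zn n * Zn n :=
  let a' : Zn n := [ffun i => (a i : nat)%:Z] in (a', m - l + a').
apply: (@sub_finite_set _ _ [set f a | a in setT]); last first.
  by apply: finite_image; exact: finite_finset.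
move=> [a b] [/= a0 b0 lamb la0].
have aN i : (`|a i| < N.+1)%N.
  rewrite ltnS; apply: leq_trans (leq_bigmax i) => /=.
  have := la0 i; rewrite !ffunE subr_ge0 => lai; have ai0 := a0 i.
  by rewrite -lez_nat !gez0_abs // (le_trans ai0).
exists [ffun i => Ordinal (aN i)] => //; rewrite /f.
have aE : [ffun i =>
    (([ffun i => Ordinal (aN i)] : {ffun 'Z_n -> 'I_N.+1}) i : nat)%:Z] = a.
  by apply/ffunP => i; rewrite !ffunE /= gez0_abs.
rewrite aE; congr pair; apply/ffunP => i; rewrite !ffunE.
have /ffunP/(_ i) := lamb; rewrite !ffunE => lambi.
by rewrite -[a i]opprK -[- a i](addKr (l i)) lambi; ring.
Qed.

Lemma Theta1_eq0 (l : Zn n) : (1 < n)%N -> Theta1 l = Theta0 n -> l = 0.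
Proof.
move=> n_gt1 l0; apply/ffunP => k; rewrite ffunE.
have : entry (Theta1 l) k%:Z (k%:Z + 1) = 0%N by rewrite l0.
rewrite /= /superdiag eqxx.
suff -> : res n k = k by move=> /eqP; rewrite absz_eq0 => /eqP.
rewrite /res modz_small; last by have := ltn_ord k; rewrite /Zp_trunc; lia.
by rewrite -[RHS]natr_Zp -pmulrn.
Qed.

Lemma Theta1_0 : Theta1 (0 : Zn n) = Theta0 n.
Proof. by apply: Thetap_ext => i j; rewrite /= /superdiag ffunE if_same. Qed.

End Characters.

(** * The characters on D *)

(* Without these declarations, failing unification attempts unfold the quotient
   constructions and practically do not terminate. *)
#[local] Opaque chi_free fgen.

Section CharactersOfD.
Variables (n : nat).
Hypothesis n_gt1 : (1 < n)%N.
Implicit Types A B C : Thetap n.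

Lemma fsbig_only1 (R : Type) (idx : R) (op : Monoid.com_law idx) (I : choiceType)
    (D : set I) (F : I -> R) i0 : D i0 -> (forall i, D i -> i <> i0 -> F i = idx) ->
  \big[op/idx]_(i \in D) F i = F i0.
Proof.
move=> Di0 Fi; rewrite -(fsbig_set1 op i0); apply/esym/fsbig_widen.
  by move=> _ ->.
by move=> i [Di ii0] /=; exact: Fi.
Qed.

Lemma chi_free_hall_sum (c : Qv) (g : Thetap n -> gen n) A B (a : Qv) :
  (forall C, chi_gen c (g C) = (C == Theta0 n)%:R) ->
  (A = Theta0 n -> B = Theta0 n -> a = 1) ->
  chi_free c (\sum_(C \in setT) (a * hall A B C) *: fgen (g C)) =
    (A == Theta0 n)%:R * (B == Theta0 n)%:R.
Proof.
move=> gE a1; have [[A0 B0]|AB0] := pselect (A = Theta0 n /\ B = Theta0 n).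
  rewrite (@fsbig_only1 _ _ _ _ _ _ (Theta0 n)) // => [|C _ C0]; last first.
    by rewrite hall_trivial_neq ?mulr0 ?scale0r //; tauto.
  by rewrite chi_freeZ chi_free_gen gE a1 // A0 B0 hall0 // !eqxx !mulr1.
(* Every term is killed by itself: for C <> 0 the generator goes to 0, for C = 0 the Hall number
   vanishes. *)
rewrite raddf_sum big1 => [|C _]; last first.
  rewrite /= chi_freeZ chi_free_gen gE; have [->|] := eqVneq; last by rewrite mulr0.
  by rewrite hall_trivial_neq ?mulr0 ?mul0r //; tauto.
have [A0|] := eqVneq A; last by rewrite mul0r.
have [B0|] := eqVneq B; last by rewrite mulr0.
by case: AB0.
Qed.

Lemma chi_free_fsum c (I : choiceType) (D : set I) (F : I -> freeA n) :
  finite_set D -> chi_free c (\sum_(i \in D) F i) = \sum_(i \in D) chi_free c (F i).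
Proof. by move=> Dfin; rewrite !fsbig_finite // raddf_sum. Qed.

(** Only the index (0, 0) survives, and it lies in [comm_range l m] exactly when l = m. *)
Lemma chi_free_comm_sum c (l m : Zn n) (coef : Zn n * Zn n -> Qv)
    (X : Zn n * Zn n -> freeA n) : nonneg l -> nonneg m ->
  (forall ab, chi_free c (X ab) = (ab == (0, 0))%:R) ->
  chi_free c (\sum_(ab \in comm_range l m) coef ab *: X ab) =
    (l == m)%:R * coef (0, 0).
Proof.
move=> l0 m0 XE; rewrite chi_free_fsum; last exact: comm_range_finite.
have [lm|lm] := eqVneq l m.
  rewrite (@fsbig_only1 _ _ _ _ _ _ (0, 0)) => [||ab _ ab0].
  - by rewrite chi_freeZ XE eqxx mulr1 mul1r.
  - by split; rewrite /= ?subr0 // => i; rewrite ffunE.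
  - by rewrite chi_freeZ XE; have [//|] := eqVneq; rewrite mulr0.
rewrite fsbig1 ?mul0r // => ab [_ _ labm _].
rewrite chi_freeZ XE; have [ab0|] := eqVneq; last by rewrite mulr0.
by move: labm; rewrite ab0 /= !subr0 => lm'; rewrite lm' eqxx in lm.
Qed.

Lemma chi_free_Kmon c (j : Zn n) :
  chi_free c (Kmon (fun i => fgen (GK n i)) (fun i => fgen (GKV n i)) j) =
    \prod_(1 <= i < n.+1) c ^ j (res n i).
Proof.
rewrite Kmon_morph; apply: eq_bigr => i _ /=.
by rewrite !chi_free_gen /= zpowE.
Qed.

Lemma chi_free_Ktmon c (j : Zn n) : c != 0 ->
  chi_free c (Ktmon (fun i => fgen (GK n i)) (fun i => fgen (GKV n i)) j) = 1.
Proof.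
move=> c0; rewrite Ktmon_morph; apply: big1 => i _ /=.
rewrite !chi_free_gen /= mulfV //.
by case: (j _) => k /=; rewrite expr1n.
Qed.

Lemma Theta1_eq (l : Zn n) : (Theta1 l == Theta0 n) = (l == 0).
Proof.
apply/eqP/eqP => [|->]; [exact: Theta1_eq0|exact: Theta1_0].
Qed.

Lemma chi_free_drel c x y : c != 0 -> @drel n x y -> chi_free c x = chi_free c y.
Proof.
move=> c0; case=> {x y} [i|i j|i|i|||j A|j A|A B|A B|l m l0 m0].
- by rewrite [LHS]chi_free_gen [RHS]chi_free_gen.
- by rewrite [LHS]chi_freeM [RHS]chi_freeM [LHS]mulrC.
- by rewrite [LHS]chi_freeM [RHS]chi_free1 2!chi_free_gen /= mulfV.
- by rewrite [LHS]chi_freeM [RHS]chi_free1 2!chi_free_gen /= mulVf.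
- by rewrite [LHS]chi_free_gen [RHS]chi_free1 /= eqxx.
- by rewrite [LHS]chi_free_gen [RHS]chi_free1 /= eqxx.
- rewrite [RHS]chi_freeZ [LHS]chi_freeM [X in _ = _ * X]chi_freeM chi_free_gen /= mulrC.
  have [->|] := eqVneq A; last by rewrite !mul0r mulr0.
  by rewrite dimvec0 euler0l expr0z !mul1r.
- rewrite [RHS]chi_freeZ [LHS]chi_freeM [X in _ = _ * X]chi_freeM chi_free_gen /= mulrC.
  have [->|] := eqVneq A; last by rewrite !mulr0.
  by rewrite dimvec0 euler0l expr0z !mul1r.
- rewrite [LHS]chi_freeM 2!chi_free_gen /=.
  rewrite [RHS](@chi_free_hall_sum c (@Gp n)) // => -> _.
  by rewrite dimvec0 euler0l.
- rewrite [LHS]chi_freeM 2!chi_free_gen /= [LHS]mulrC.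
  rewrite [RHS](@chi_free_hall_sum c (@Gm n)) // => -> _.
  by rewrite dimvec0 euler0l.
rewrite [LHS]chi_freeZ [RHS]chi_freeZ.
rewrite [X in _ * X = _]chi_free_comm_sum //; last first.
  move=> [a b]; rewrite [LHS]chi_freeM [X in X * _]chi_freeM 2!chi_free_gen.
  rewrite chi_free_Ktmon //= mul1r.
  by rewrite !Theta1_eq xpair_eqE -natrM mulnb andbC.
rewrite [X in _ = _ * X]chi_free_comm_sum //; last first.
  move=> [a b]; rewrite [LHS]chi_freeM [X in X * _]chi_freeM 2!chi_free_gen.
  rewrite chi_free_Ktmon //= mul1r.
  by rewrite !Theta1_eq xpair_eqE -natrM mulnb.
(* For l = m what is left on each side is the coefficient at (0, 0), where the Euler forms involving
   0 vanish. *)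
have [->|] := eqVneq l m; last by rewrite !mul0r !mulr0.
by rewrite /= !subr0 !euler0l !euler0r addr0.
Qed.

(** Evaluation on a chosen representative; for c <> 0 the choice is immaterial by [chi_api]. *)
Definition chi (c : Qv) (x : DRH n) : Qv := chi_free c (lrep x).

Lemma chi_api c (x : freeA n) : c != 0 -> chi c (api _ x) = chi_free c x.
Proof.
move=> c0; pose R := [set x : freeA n | exists y z, drel y z /\ x = y - z].
have /asboolP H : scar (ideal R) (lrep (api R x) - x) := lrep_pi (ideal R) x.
apply/eqP; rewrite -subr_eq0 -[_ - _](rmorphB (chi_free c)); apply/eqP.
(* The kernel of [chi_free c] is a two-sided ideal containing the relations, hence contains the
   ideal they generate. *)
apply: (H [set y | chi_free c y = 0]); split=> [|_ [y [z [yz ->]]] /=]; last first.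
  by rewrite rmorphB /= (chi_free_drel _ yz) // subrr.
split=> [|y z /= y0 z0|a y /= y0]; first exact: rmorph0.
  by rewrite rmorphB /= y0 z0 subr0.
by split; rewrite [LHS]chi_freeM y0 ?mulr0 ?mul0r.
Qed.

Section Fixed.
Variable c : Qv.
Hypothesis c0 : c != 0.

Lemma chiB x y : chi c (x - y) = chi c x - chi c y.
Proof.
by rewrite -[x]lrepK -[y]lrepK -!/(api _ _) -raddfB !chi_api // rmorphB.
Qed.

Lemma chi1 : chi c 1 = 1.
Proof. by rewrite -[1]/(api _ 1) chi_api // rmorph1. Qed.

Lemma chiM x y : chi c (x * y) = chi c x * chi c y.
Proof.
by rewrite -[x]lrepK -[y]lrepK -!/(api _ _) -rmorphM !chi_api // rmorphM.
Qed.

Lemma chiZ a x : chi c (a *: x) = a * chi c x.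
Proof.
by rewrite -[x]lrepK -!/(api _ _) -[a *: _]linearZ !chi_api // chi_freeZ.
Qed.

Lemma chi_dgen g : chi c (dgen g) = chi_gen c g.
Proof. by rewrite chi_api // chi_free_gen. Qed.

End Fixed.
End CharactersOfD.

(** * Central scalars and residues modulo n *)

Lemma malg_scalerAr (M : monomType) (R : comNzRingType) (a : R) (x y : {malg R[M]}) :
  x * (a *: y) = a *: (x * y).
Proof.
suff comm (z : {malg R[M]}) : z * a%:MP = a *: z.
  by rewrite -mul_malgC mulrA comm -scalerAl.
rewrite -mul_malgC [LHS]fgmulgU [RHS]fgmulUg.
by apply: eq_bigr => k _; rewrite mulrC mulm1 mul1m.
Qed.

Lemma val_res n (i : int) : (1 < n)%N -> (val (res n i) : nat)%:Z = (i %% n%:Z)%Z.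
Proof.
move=> n_gt1; rewrite /res; have := @modz_ge0 i n%:Z; have := @ltz_pmod i n%:Z.
case: (i %% n%:Z)%Z => k; last by lia.
move=> kn _; rewrite -pmulrn /= val_Zp_nat // modn_small //; lia.
Qed.

Lemma res_inj n (i j : int) : (1 < n)%N -> 1 <= i <= n%:Z -> 1 <= j <= n%:Z ->
  res n i = res n j -> i = j.
Proof.
move=> n_gt1 i1n j1n ij.
have : (i %% n%:Z)%Z = (j %% n%:Z)%Z by rewrite -!val_res // ij.
have ii : i = n%:Z \/ (i %% n%:Z)%Z = i.
  by have [->|] := eqVneq i n%:Z; [left|right; rewrite modz_small //; lia].
have jj : j = n%:Z \/ (j %% n%:Z)%Z = j.
  by have [->|] := eqVneq j n%:Z; [left|right; rewrite modz_small //; lia].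
by case: ii jj => [->|->] [->|->] //; rewrite modzz; lia.
Qed.

Lemma prod_res n (R : comPzRingType) (f : 'Z_n -> R) : (1 < n)%N ->
  \prod_(1 <= i < n.+1) f (res n i) = \prod_i f i.
Proof.
case: n f => [|[|n]] f // n_gt1; rewrite big_add1 /= big_mkord.
(* The left side runs over the residues of 1, ..., n, which are those of 0, ..., n - 1 translated by
   1. *)
rewrite [RHS](reindex_inj (addIr 1)); apply: eq_bigr => i _; congr f.
apply/val_inj/eqP; rewrite -eqz_nat val_res //= modz_nat.
by rewrite modnDmr addn1.
Qed.

Section DRHScaling.
Variable n : nat.
Implicit Types x y : DRH n.

Lemma DRH_scalerAl a x y : a *: (x * y) = (a *: x) * y.
Proof.
rewrite -[x]lrepK -[y]lrepK -!/(api _ _) -[a *: api _ (lrep x)]linearZ.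
by rewrite -[LHS]/(a *: (api _ (lrep x) * api _ (lrep y))) -!rmorphM -linearZ scalerAl.
Qed.

Lemma DRH_scalerAr a x y : a *: (x * y) = x * (a *: y).
Proof.
rewrite -[x]lrepK -[y]lrepK -!/(api _ _) -[a *: api _ (lrep y)]linearZ.
by rewrite -!rmorphM -linearZ malg_scalerAr.
Qed.

End DRHScaling.

(** * Projections to the modified algebra *)

#[local] Opaque api amul lpi lrep.

Lemma scalerXz_move (F : fieldType) (V : lmodType F) (q : F) (a b : int) (x y : V) :
  q != 0 -> q ^ a *: x = q ^ b *: y -> x = q ^ (b - a) *: y.
Proof.
move=> q0 xy; rewrite addrC expfzDr // -scalerA -xy scalerA -expfzDr //.
by rewrite addNr expr0z scale1r.
Qed.

Lemma scaler_ups_eq0 (V : lmodType Qv) (a b : int) (x : V) :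
  ups ^ a *: x = ups ^ b *: x -> a != b -> x = 0.
Proof.
move=> /eqP; rewrite -subr_eq0 -scalerBl scaler_eq0 => /orP[|/eqP //].
by rewrite subr_eq0 => /eqP /exprz_ups_inj ->; rewrite eqxx.
Qed.

Section Projections.
Variable n : nat.
Implicit Types (A B C : Thetap n) (l m j : Zn n) (x y w : DRH n).

Definition delta (i : 'Z_n) (z : int) : Zn n := [ffun k => if k == i then z else 0].

Lemma dot_delta l i z : dot l (delta i z) = l i * z.
Proof.
rewrite /dot (bigD1 i) //= ffunE eqxx big1 ?addr0 // => k ki.
by rewrite ffunE (negPf ki) mulr0.
Qed.

Lemma dotBl l m j : dot (l - m) j = dot l j - dot m j.
Proof.
by rewrite /dot -sumrB; apply: eq_bigr => i _; rewrite !ffunE mulrBl.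
Qed.

(** The exponent in the commutation of K^j with u_A is the pairing of j with the degree of u_A^+; so
    passing u_A^+ or u_A^- shifts weights by [degu A]. *)
Lemma euler_dimvec A j : euler (dimvec A) j = dot (degu A) j.
Proof.
rewrite /euler -sumrB /dot /degu.
under [RHS]eq_bigr => k _ do rewrite sum_ffunE mulr_suml.
rewrite exchange_big /=; apply: eq_bigr => i _.
have E (k : 'Z_n) : (alpha i *~ dimvec A i) k * j k =
    dimvec A i * ((if k == i then j k else 0) - (if k == i + 1 then j k else 0)).
  rewrite ffunMzE !ffunE -mulrzl intz -mulrA mulrBl.
  by do 2!case: (k == _); rewrite ?mul1r ?mul0r.
under [RHS]eq_bigr => k _ do rewrite E.
by rewrite -mulr_sumr sumrB -!big_mkcond !big_pred1_eq mulrBr.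
Qed.

Lemma api_drel (u v : freeA n) : drel u v -> api _ u = api _ v :> DRH n.
Proof.
move=> uv; apply/lpi_eq/asboolP.
by apply: sub_gen_smallest; exists u, v.
Qed.

Lemma Kpow_api j :
  Kpow j = api _ (Kmon (fun i => fgen (GK n i)) (fun i => fgen (GKV n i)) j).
Proof. by rewrite Kmon_morph. Qed.

Lemma apiM (u v : freeA n) : api _ (u * v) = api _ u * api _ v :> DRH n.
Proof. exact: rmorphM. Qed.

Lemma apiZ a (u : freeA n) : api _ (a *: u) = a *: api _ u :> DRH n.
Proof. exact: linearZ. Qed.

Lemma Kpow_up j A : Kpow j * up A = ups ^ euler (dimvec A) j *: (up A * Kpow j).
Proof.
rewrite Kpow_api -[LHS]apiM [LHS](api_drel (drelKp j A)) [LHS]apiZ.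
by rewrite [X in _ *: X = _]apiM.
Qed.

Lemma um_Kpow j A : um A * Kpow j = ups ^ euler (dimvec A) j *: (Kpow j * um A).
Proof.
rewrite Kpow_api -[LHS]apiM [LHS](api_drel (drelmK j A)) [LHS]apiZ.
by rewrite [X in _ *: X = _]apiM.
Qed.

Lemma up0 : up (Theta0 n) = 1.
Proof. exact: api_drel (drelp0 n). Qed.

Lemma um0 : um (Theta0 n) = 1.
Proof. exact: api_drel (drelm0 n). Qed.

Lemma Kpow_delta (i : int) z : (1 < n)%N -> 1 <= i <= n%:Z ->
  Kpow (delta (res n i) z) = zpow (KD n i) (KVD n i) z.
Proof.
move=> n_gt1; case: i => [k|k]; last by lia.
move=> /andP[k_ge1 k_len]; rewrite /Kpow /Kmon.
have k1 : (1 <= k)%N by lia.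
have kn : (k <= n)%N by lia.
have triv (s : nat) : (1 <= s <= n)%N -> s <> k ->
    zpow (KD n s) (KVD n s) (delta (res n k) z (res n s)) = 1.
  move=> s1n sk; rewrite ffunE; case: eqP => // /res_inj sk'.
  by case: sk; have := sk' n_gt1 _ _; lia.
rewrite (@big_cat_nat _ _ _ k) ?(leq_trans kn) //=.
rewrite big_nat big1 ?mul1r => [|s sk]; last by apply: triv; lia.
rewrite big_ltn //= big_nat big1 ?mulr1 => [|s sk]; last by apply: triv; lia.
by rewrite ffunE eqxx.
Qed.

#[local] Opaque Kpow up um Kmon.

(** * Weights and diagonal action *)

Lemma pilmP l m a x y : pilm l m (a *: x + y) = a *: pilm l m x + pilm l m y.
Proof. exact: linearP. Qed.

Lemma pilmZ l m a x : pilm l m (a *: x) = a *: pilm l m x.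
Proof. exact: linearZ. Qed.

Lemma pilm_Kpowl l m j y : pilm l m (Kpow j * y) = ups ^ dot l j *: pilm l m y.
Proof.
rewrite -pilmZ; apply/lpi_eq/asboolP; apply: sub_gen_smallest; exists j, y; left.
by rewrite mulrBl -DRH_scalerAl mul1r.
Qed.

Lemma pilm_Kpowr l m j y : pilm l m (y * Kpow j) = ups ^ dot m j *: pilm l m y.
Proof.
rewrite -pilmZ; apply/lpi_eq/asboolP; apply: sub_gen_smallest; exists j, y; right.
by rewrite mulrBr -DRH_scalerAr mulr1.
Qed.

(** Moved to the far left, K^j acts by the weight l; undoing the commutation with u_A^+ lowers this
    weight by [degu A]. *)
Lemma pilm_up_Kpow A l m j w :
  pilm l m (up A * (Kpow j * w)) = ups ^ dot (l - degu A) j *: pilm l m (up A * w).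
Proof.
have E : Kpow j * (up A * w) = ups ^ euler (dimvec A) j *: (up A * (Kpow j * w)).
  by rewrite [LHS]mulrA Kpow_up -[LHS]DRH_scalerAl -[X in _ *: X = _]mulrA.
have := etrans (congr1 (pilm l m) (esym E)) (pilm_Kpowl l m j (up A * w)).
move/(etrans (esym (pilmZ _ _ _ _))).
by rewrite dotBl -euler_dimvec; exact: scalerXz_move ups_neq0.
Qed.

Lemma pilm_Kpow_um B l m j w :
  pilm l m (w * Kpow j * um B) = ups ^ dot (m - degu B) j *: pilm l m (w * um B).
Proof.
have E : w * um B * Kpow j = ups ^ euler (dimvec B) j *: (w * Kpow j * um B).
  by rewrite -[LHS]mulrA um_Kpow -[LHS]DRH_scalerAr [X in _ *: X = _]mulrA.
have := etrans (congr1 (pilm l m) (esym E)) (pilm_Kpowr l m j (w * um B)).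
move/(etrans (esym (pilmZ _ _ _ _))).
by rewrite dotBl -euler_dimvec; exact: scalerXz_move ups_neq0.
Qed.

(** A K_k placed between the two factors acts by a power of [ups] read off from either side. If the
    two exponents differ for some k, the projection must vanish. *)
Lemma pilm_up_um_eq0 A B l m :
  l - degu A <> m - degu B -> pilm l m (up A * um B) = 0.
Proof.
move=> lm; have [k lmk] : exists k, (l - degu A) k != (m - degu B) k.
  apply: contrapT => H; apply: lm; apply/ffunP => k; apply/eqP/contraT => lmk.
  by case: H; exists k.
have e1 := pilm_Kpow_um B l m (delta k 1) (up A).
have e2 := pilm_up_Kpow A l m (delta k 1) (um B).
have := etrans (esym e1) (etrans (congr1 (pilm l m) (esym (mulrA _ _ _))) e2).
move/scaler_ups_eq0; apply; rewrite 2!dot_delta 2!mulr1.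
by rewrite eq_sym.
Qed.

(** Expresses z 1_l = f(l) 1_l inside the quotients: l - degu A is the weight just to the right of
    u_A^+. The free factor w makes the property stable under products. *)
Definition diag_action (z : DRH n) (f : Zn n -> Qv) :=
  forall A l m w, pilm l m (up A * (z * w)) = f (l - degu A) *: pilm l m (up A * w).

Lemma diag_actionP a x y f g : diag_action x f -> diag_action y g ->
  diag_action (a *: x + y) (fun l => a * f l + g l).
Proof.
move=> xf yg A l m w.
have E : up A * ((a *: x + y) * w) = a *: (up A * (x * w)) + up A * (y * w).
  by rewrite [RHS]addrC DRH_scalerAr DRH_scalerAl -mulrDr -mulrDl [in RHS]addrC.
rewrite [LHS](congr1 (pilm l m) E) [LHS]pilmP [RHS]scalerDl -[X in _ = X + _]scalerA.
exact: (congr2 (fun u v => a *: u + v) (xf A l m w) (yg A l m w)).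
Qed.

Lemma diag_actionZ a x f : diag_action x f -> diag_action (a *: x) (fun l => a * f l).
Proof.
move=> xf A l m w; have E : up A * ((a *: x) * w) = a *: (up A * (x * w)).
  by rewrite [RHS]DRH_scalerAr DRH_scalerAl.
rewrite [LHS](congr1 (pilm l m) E) [LHS]pilmZ -[RHS]scalerA.
exact: (congr1 (fun u => a *: u) (xf A l m w)).
Qed.

Lemma diag_actionB x y f g : diag_action x f -> diag_action y g ->
  diag_action (x - y) (fun l => f l - g l).
Proof.
move=> xf yg A l m w; have E : up A * ((x - y) * w) = up A * (x * w) - up A * (y * w).
  by rewrite -[RHS]mulrBr -mulrBl.
rewrite [LHS](congr1 (pilm l m) E) [LHS](raddfB (lpi (lspan (Dlm_rel l m)))).
rewrite [RHS]scalerBl.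
exact: (congr2 (fun u v => u - v) (xf A l m w) (yg A l m w)).
Qed.

Lemma diag_actionM x y f g : diag_action x f -> diag_action y g ->
  diag_action (x * y) (fun l => f l * g l).
Proof. move=> xf yg A l m w.
rewrite -[RHS]scalerA -[in RHS]yg -[RHS]xf.
exact: (congr1 (fun z => pilm l m (up A * z)) (esym (mulrA x y w))). Qed.

Lemma diag_action0 : diag_action 0 (fun=> 0).
Proof.
move=> A l m w; rewrite [RHS]scale0r -[RHS](raddf0 (lpi (lspan (Dlm_rel l m)))).
exact: (congr1 (pilm l m) (etrans (congr1 ( *%R (up A)) (mul0r w)) (mulr0 (up A)))).
Qed.

Lemma diag_action1 : diag_action 1 (fun=> 1).
Proof. by move=> A l m w; rewrite [RHS]scale1r (mul1r w). Qed.

Lemma diag_action_Kpow j : diag_action (Kpow j) (fun l => ups ^ dot l j).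
Proof. by move=> A l m w; exact: pilm_up_Kpow. Qed.

Lemma diag_action_prod (I : Type) (s : seq I) (F : I -> DRH n) (f : I -> Zn n -> Qv) :
  (forall i, diag_action (F i) (f i)) ->
  diag_action (\prod_(i <- s) F i) (fun l => \prod_(i <- s) f i l).
Proof.
move=> Ff; elim: s => [|i s IH] A l m w.
  by rewrite 2!big_nil; exact: diag_action1.
by rewrite 2!big_cons; exact: (diag_actionM (Ff i) IH).
Qed.

Lemma diag_action_ext z f g : diag_action z f -> f =1 g -> diag_action z g.
Proof. by move=> zf fg A l m w; rewrite -fg; exact: zf. Qed.

Hypothesis n_gt1 : (1 < n)%N.

Lemma diag_action_KD (i : int) : 1 <= i <= n%:Z ->
  diag_action (KD n i) (fun l => ups ^ l (res n i)).
Proof.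
move=> i1n; have KE : Kpow (delta (res n i) 1) = KD n i := Kpow_delta 1 n_gt1 i1n.
rewrite -KE; apply: diag_action_ext (diag_action_Kpow _) _ => l.
by rewrite dot_delta mulr1.
Qed.

Lemma diag_action_KVD (i : int) : 1 <= i <= n%:Z ->
  diag_action (KVD n i) (fun l => ups ^ (- l (res n i))).
Proof.
move=> i1n; have KE : Kpow (delta (res n i) (-1)) = KVD n i :=
  Kpow_delta (-1) n_gt1 i1n.
rewrite -KE; apply: diag_action_ext (diag_action_Kpow _) _ => l.
by rewrite dot_delta mulrN1.
Qed.

Lemma diag_action_Kbinom (i : int) t : 1 <= i <= n%:Z ->
  diag_action (Kbinom n i t) (fun l => gauss ups (l (res n i)) t).
Proof.
move=> i1n; apply: diag_action_prod => s.
apply: diag_action_ext (diag_actionZ _ (diag_actionB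
  (diag_actionZ _ (diag_action_KD i1n)) (diag_actionZ _ (diag_action_KVD i1n)))) _ => l.
rewrite -!expfzDr ?ups_neq0 // mulrC /qbr -exprnN.
by congr ((ups ^ _ - ups ^ _) / _); ring.
Qed.

(** The elements acting by scalars in [Zv] form a [Zv]-subalgebra; on the generators the scalars are
    powers of [ups] and Gaussian binomials. *)
Lemma Dz_diag_action z : Dz z -> exists2 f, diag_action z f & forall l, Zv (f l).
Proof.
apply: (smallest_sub (X := [set z | exists2 f, diag_action z f & forall l, Zv (f l)])).
  split=> [|/=|x y [f xf fZ] [g yg gZ]].
  - split=> [/=|a x y aZ [f xf fZ] [g yg gZ]].
      by exists (fun=> 0); [exact: diag_action0|move=> _; exact: Zv0].
    exists (fun l => a * f l + g l); first exact: diag_actionP.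
    by move=> l; apply: ZvD => //; exact: ZvM.
  - by exists (fun=> 1); [exact: diag_action1|move=> _; exact: Zv1].
  - exists (fun l => f l * g l); first exact: diag_actionM.
    by move=> l; exact: ZvM.
move=> _ [i [i1n [->|[->|[t _ ->]]]]] /=.
- by eexists; [exact: diag_action_KD|move=> l; exact: Zv_ups].
- by eexists; [exact: diag_action_KVD|move=> l; exact: Zv_ups].
- by eexists; [exact: diag_action_Kbinom|move=> l; exact: Zv_gauss].
Qed.

End Projections.

(** * The completion *)

#[local] Opaque pilm.

Lemma fsum_scalerP (K : fieldType) (V : lmodType K) (I : choiceType) (D : set I)
    (a : K) (c c' : I -> K) (X : I -> V) : finite_set D ->
  \sum_(t \in D) (a * c t + c' t) *: X t =
    a *: (\sum_(t \in D) c t *: X t) + \sum_(t \in D) c' t *: X t.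
Proof.
move=> Dfin; rewrite !fsbig_finite // scaler_sumr -big_split /=.
by apply: eq_bigr => t _; rewrite scalerDl scalerA.
Qed.

Section Completion.
Variable n : nat.
Implicit Types (A B : Thetap n) (l m : Zn n) (x y : DRH n) (b : coefs n).

Lemma PhiE x l m : Phi x l m = pilm l m x.
Proof.
rewrite /Phi (@fsbig_only1 _ _ _ _ _ _ m) // /mul_idem ?eqxx // => i _ im.
by case: eqP => // mi; case: im.
Qed.

(** A triple contributes to the component at (l, m) only if its left weight is l. This lets several
    combinations be summed over one common finite set. *)
Lemma combo_finite b l m (F : set (Thetap n * Zn n * Thetap n)) :
  [set t | b t <> 0 /\ t.1.2 + degu t.1.1 = l] `<=` F ->
  combo b l m = \sum_(t \in F) b t *: basis_elt t.1.1 t.1.2 t.2 l m.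
Proof.
move=> bF; apply/esym/fsbig_widen => // t [_ Ft] /=.
have [->|b0] := pselect (b t = 0); first exact: scale0r.
rewrite /basis_elt /pi_at; case: eqP => [[le _]|_]; last exact: scaler0.
by case: Ft; apply: bF.
Qed.

Lemma comboP a b b' l m : admissible b -> admissible b' ->
  combo (fun t => a * b t + b' t) l m = a *: combo b l m + combo b' l m.
Proof.
move=> bA b'A.
pose S (c : coefs n) := [set t | c t <> 0 /\ t.1.2 + degu t.1.1 = l].
(* Admissibility at the left weight l makes both supports finite. *)
pose F := S b `|` S b'.
have Ffin : finite_set F.
  by rewrite finite_setU; split; [have [_] := bA l|have [_] := b'A l];
    apply: sub_finite_set => t [/eqP].
rewrite (@combo_finite _ _ _ F); last first.
  move=> t [/= ct tl]; have [b0|b0] := pselect (b t = 0); last by left.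
  by right; split=> // b'0; apply: ct; rewrite b0 b'0 mulr0 addr0.
rewrite [X in _ = a *: X + _](@combo_finite _ _ _ F); last by move=> t; left.
rewrite [X in _ = _ + X](@combo_finite _ _ _ F); last by move=> t; right.
exact: fsum_scalerP.
Qed.

Lemma admissibleP a b b' : admissible b -> admissible b' ->
  admissible (fun t => a * b t + b' t).
Proof.
move=> bA b'A m; have [b1 b2] := bA m; have [b1' b2'] := b'A m.
have supp t : a * b t + b' t != 0 -> b t != 0 \/ b' t != 0.
  have [->|] := eqVneq (b t) 0; last by left.
  by rewrite mulr0 add0r; right.
split; [apply: sub_finite_set (_ : _ `<=` _ `|` _) _;
  last by rewrite finite_setU; split; [exact: b1|exact: b1']|
  apply: sub_finite_set (_ : _ `<=` _ `|` _) _;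
  last by rewrite finite_setU; split; [exact: b2|exact: b2']];
by move=> t /= [/supp[]]; [left|right].
Qed.

Lemma Dhat_span x y a : Zv a -> Dhat Zv (Phi x) -> Dhat Zv (Phi y) ->
  Dhat Zv (Phi (a *: x + y)).
Proof.
move=> aZ [b [bA bZ xb]] [b' [b'A b'Z yb']].
exists (fun t => a * b t + b' t); split; first exact: admissibleP.
  by move=> t; apply: ZvD => //; exact: ZvM.
apply/functional_extensionality_dep => l.
apply/functional_extensionality_dep => m.
rewrite comboP // -xb -yb' 3!PhiE; exact: pilmP.
Qed.

Lemma Dhat0 : Dhat Zv (Phi (0 : DRH n)).
Proof.
exists (fun=> 0); split=> [m|_|]; [|exact: Zv0|].
  by split; apply: (sub_finite_set _ (finite_set0 _)) => t /= []; rewrite eqxx.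
apply/functional_extensionality_dep => l.
apply/functional_extensionality_dep => m.
rewrite PhiE /combo fsbig1 => [|t _]; last exact: scale0r.
exact: (raddf0 (lpi (lspan (Dlm_rel l m)))).
Qed.

(** The expansion is the sum over all l of f(l) u_A^+ 1_l u_B^-. It is admissible because A, B and
    either outer weight determine l. *)
Lemma Dhat_diag_action A B z f : diag_action z f -> (forall l, Zv (f l)) ->
  Dhat Zv (Phi (up A * z * um B)).
Proof.
move=> zf fZ.
pose b : coefs n := fun t => if (t.1.1 == A) && (t.2 == B) then f t.1.2 else 0.
have b_supp t : b t <> 0 -> t = (A, t.1.2, B).
  by case: t => [[A' l] B']; rewrite /b /=; case: andP => // -[/eqP-> /eqP->].
exists b; split=> [m|t|]; last 2 first.
- by rewrite /b; case: ifP => _ //; exact: Zv0.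
- apply/functional_extensionality_dep => l.
  apply/functional_extensionality_dep => m.
  rewrite PhiE /combo (@fsbig_only1 _ _ _ _ _ _ (A, l - degu A, B)) //=; last first.
    move=> t _ tl; have [->|b0] := pselect (b t = 0); first exact: scale0r.
    rewrite /basis_elt /pi_at; case: eqP => [[le _]|_]; last exact: scaler0.
    by case: tl; rewrite (b_supp t b0) le (b_supp t b0) /= addrK.
  have -> : b (A, l - degu A, B) = f (l - degu A) by rewrite /b /= !eqxx.
  rewrite [LHS](congr1 (pilm l m) (esym (mulrA _ _ _))) [LHS](zf A l m (um B)).
  (* When m is not the right weight of the triple, the basis element has component 0 there, and so
     has the projection of u_A^+ u_B^-. *)
  congr (_ *: _); rewrite /basis_elt /pi_at subrK; case: eqP => // lm.
  apply: pilm_up_um_eq0 => lm'; apply: lm.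
  by rewrite lm' subrK.
(* The boolean selects between the two finiteness conditions of [admissible]. *)
have sub1 (C : bool) D :
    [set t | b t != 0 /\ t.1.2 + degu (if C then t.2 else t.1.1) = D] `<=`
    [set (A, D - degu (if C then B else A), B)].
  move=> t /= [/eqP/b_supp tE <-]; move: tE; case: t => [[A' l] B'] [-> ->] /=.
  by case: C; rewrite addrK.
split; [apply: sub_finite_set (sub1 true m) _
  |apply: sub_finite_set (sub1 false m) _].
all: exact: finite_set1.
Qed.

End Completion.

(** * The counterexample *)

#[local] Opaque chi KD KVD Phi.

Section Counterexample.
Variable n : nat.
Hypothesis n_gt1 : (1 < n)%N.
Implicit Types (A B : Thetap n) (l m : Zn n) (x y z : DRH n).

Section ChiD.
Variable c : Qv.
Hypothesis c0 : c != 0.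

Lemma chi0 : chi c (0 : DRH n) = 0.
Proof. by rewrite -(subrr 0) chiB // subrr. Qed.

Lemma chiP a x y : chi c (a *: x + y) = a * chi c x + chi c y.
Proof.
have E : a *: x + y = a *: x - (0 - y) by rewrite sub0r opprK.
by rewrite [LHS](congr1 (chi c) E) 2?chiB // chiZ // chi0 sub0r opprK.
Qed.

Lemma chi_Kpow j : chi c (Kpow j : DRH n) = c ^ (\sum_i j i).
Proof.
rewrite Kpow_api chi_api // chi_free_Kmon (prod_res (fun i => c ^ j i)) //.
by elim/big_rec2: _ => [|i p q _ ->]; rewrite ?expfzDr.
Qed.

Lemma chi_prod (I : Type) (s : seq I) (F : I -> DRH n) :
  chi c (\prod_(i <- s) F i) = \prod_(i <- s) chi c (F i).
Proof.
elim: s => [|i s IH]; first by rewrite 2!big_nil; exact: chi1.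
by rewrite 2!big_cons -IH; exact: chiM.
Qed.

End ChiD.

(** On this weight K^j acts by [ups] to the k times the sum of j, which is also the value of
    [chi (ups ^+ k)] at K^j. *)
Definition const_weight (k : nat) : Zn n := [ffun=> k%:Z].

Lemma dot_const_weight k j : dot (const_weight k) j = k%:Z * \sum_i j i.
Proof. by rewrite /dot mulr_sumr; apply: eq_bigr => i _; rewrite ffunE. Qed.

(** The character kills K^j minus its scalar on the constant weight, hence the whole subspace
    divided out at that weight. *)
Lemma chi_pilm k x y :
  pilm (const_weight k) (const_weight k) x = pilm (const_weight k) (const_weight k) y ->
  chi (ups ^+ k) x = chi (ups ^+ k) y.
Proof.
have c0 : ups ^+ k != 0 by rewrite expf_neq0 ?ups_neq0.
move=> /lpi_eq /asboolP H; apply/eqP; rewrite -subr_eq0 -chiB //; apply/eqP.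
apply: (H [set z | chi (ups ^+ k) z = 0]); split.
  split=> [|a u v _ /= u0 v0]; first exact: chi0.
  by rewrite chiP // u0 v0 mulr0 addr0.
have Krel j : chi (ups ^+ k) (Kpow j - ups ^ dot (const_weight k) j *: (1 : DRH n)) = 0.
  rewrite chiB // chiZ // chi1 // mulr1 chi_Kpow // dot_const_weight.
  by rewrite -exprz_exp subrr.
by move=> _ [j [z [->|->]]] /=; rewrite chiM // Krel ?mul0r ?mulr0.
Qed.

(** The components of [Phi] at the constant weights give the values at all c = ups^k, and a Laurent
    polynomial in c is determined by these. *)
Lemma chi_Phi_inj x y : Phi x = Phi y -> forall c, c != 0 -> chi c x = chi c y.
Proof.
move=> xy; apply: laurent_fun_eq; [exact: laurent_chi_free|exact: laurent_chi_free|].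
by move=> k; apply: chi_pilm; rewrite -!PhiE xy.
Qed.

Lemma N1_neq0 : (-1 : Qv) != 0.
Proof. by rewrite oppr_eq0 oner_eq0. Qed.

Lemma span_closed_Zv_chi : span_closed Zv [set x : DRH n | Zv (chi (-1) x)].
Proof.
have c0 := N1_neq0; split=> [|k u v kZ /= uZ vZ].
  by rewrite /= chi0 //; exact: Zv0.
by rewrite chiP //; apply: ZvD => //; exact: ZvM.
Qed.

Lemma Zv_chi_Dp a : @Dp n a -> Zv (chi (-1) a).
Proof.
apply: (smallest_sub span_closed_Zv_chi).
move=> _ [A _ <-] /=; rewrite chiZ ?N1_neq0 // chi_dgen ?N1_neq0 //=.
by apply: ZvM; [exact: Zv_ups|case: (_ == _); [exact: Zv1|exact: Zv0]].
Qed.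

Lemma Zv_chi_Dm a : @Dm n a -> Zv (chi (-1) a).
Proof.
apply: (smallest_sub span_closed_Zv_chi).
move=> _ [A _ <-] /=; rewrite chiZ ?N1_neq0 // chi_dgen ?N1_neq0 //=.
by apply: ZvM; [exact: Zv_ups|case: (_ == _); [exact: Zv1|exact: Zv0]].
Qed.

(** The factor s = 1 is a multiple of K_i - K_i^-1, and -1 is its own inverse. *)
Lemma chi_Kbinom (i : int) t : (0 < t)%N -> chi (-1) (Kbinom n i t) = 0.
Proof.
move=> t_gt0; have c0 := N1_neq0; rewrite [LHS](chi_prod c0) big_ltn //.
rewrite [X in X * _](chiZ n_gt1 c0) [X in _ * X * _](chiB n_gt1 c0).
rewrite [X in _ * (X - _) * _](chiZ n_gt1 c0) [X in _ * (_ - X) * _](chiZ n_gt1 c0).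
rewrite [X in _ * (_ * X - _) * _](chi_dgen n_gt1 c0).
rewrite [X in _ * (_ - _ * X) * _](chi_dgen n_gt1 c0) /= invrN invr1 subrr.
by rewrite mulr0 mul0r.
Qed.

Lemma Zv_chi_Dz a : @Dz n a -> Zv (chi (-1) a).
Proof.
have ZvN1 : Zv (-1) by apply: ZvN; exact: Zv1.
apply: (smallest_sub (X := [set a | Zv (chi (-1) a)])).
  split=> [||u v /= uZ vZ]; first exact: span_closed_Zv_chi; last first.
    by rewrite chiM ?N1_neq0 //; exact: ZvM.
  by rewrite /= chi1 ?N1_neq0 //; exact: Zv1.
move=> _ [i [_ [->|[->|[t t_gt0 ->]]]]] /=.
- by rewrite chi_dgen ?N1_neq0.
- by rewrite chi_dgen ?N1_neq0 //= invrN invr1.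
- by rewrite chi_Kbinom //; exact: Zv0.
Qed.

Lemma Zv_chi_Dint x : Dint x -> Zv (chi (-1) x).
Proof.
apply: (smallest_sub span_closed_Zv_chi).
move=> _ [a [b [d [aD bD dD ->]]]] /=; rewrite !chiM ?N1_neq0 //.
by apply: ZvM; [apply: ZvM; [exact: Zv_chi_Dp|exact: Zv_chi_Dz]|exact: Zv_chi_Dm].
Qed.

Lemma Dint_Dhat x : Dint x -> Dhat Zv (Phi x).
Proof.
apply: (smallest_sub (X := [set x | Dhat Zv (Phi x)])).
  by split=> [|a u v]; [exact: Dhat0|exact: Dhat_span].
move=> _ [a [b [d [aD bD dD ->]]]] /=.
have [f bf fZ] := Dz_diag_action n_gt1 bD.
(* Linearity in d and then in a reduces the claim to the generators of [Dm] and [Dp], with b acting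
   diagonally throughout. *)
move: d dD a aD.
apply: (smallest_sub (X := [set d | forall a, Dp a -> Dhat Zv (Phi (a * b * d))])).
  split=> [a _|k u v kZ /= uD vD a aD].
    by rewrite [a * b * 0]mulr0; exact: Dhat0.
  have -> : a * b * (k *: u + v) = k *: (a * b * u) + a * b * v.
    by rewrite mulrDr -DRH_scalerAr.
  by apply: Dhat_span => //; [exact: uD|exact: vD].
move=> _ [B _ <-].
apply: (smallest_sub (X := [set a | Dhat Zv (Phi (a * b * utm B))])).
  split=> [|k u v kZ /= uD vD].
    by rewrite /= mul0r [X in Phi X]mul0r; exact: Dhat0.
  have -> : (k *: u + v) * b * utm B = k *: (u * b * utm B) + v * b * utm B.
    by rewrite 2!mulrDl -2!DRH_scalerAl.
  exact: Dhat_span.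
move=> _ [A _ <-] /=.
(* The normalising powers of [ups] lie in [Zv]; the summand 0 gives the shape that [Dhat_span]
   expects. *)
have -> : utp A * b * utm B = (ups ^ ((dim_End A)%:Z - dim_M A) *
    ups ^ ((dim_End B)%:Z - dim_M B)) *: (up A * b * um B) + 0.
  by rewrite addr0 -scalerA DRH_scalerAr 2!DRH_scalerAl.
apply: Dhat_span; last exact: Dhat0; first by apply: ZvM; exact: Zv_ups.
exact: Dhat_diag_action bf fZ.
Qed.

(** At every power of [ups], the only values that K_1 takes on weights, K_1 - 1 is divisible by ups
    - 1 in [Zv]; at K_1 = -1 it is not. *)
Definition Kquot : DRH n := (ups - 1)^-1 *: (KD n 1 - 1).

Lemma Dhat_Kquot : Dhat Zv (Phi Kquot).
Proof.
have i1n : 1 <= (1 : int) <= n%:Z by lia.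
have H := diag_actionZ (ups - 1)^-1
  (diag_actionB (diag_action_KD n_gt1 i1n) (@diag_action1 n)).
have -> : Kquot = up (Theta0 n) * Kquot * um (Theta0 n).
  by rewrite up0 um0 mulr1 mul1r.
by apply: Dhat_diag_action H _ => l; exact: Zv_geometric.
Qed.

Lemma chi_Kquot : chi (-1) Kquot = (ups - 1)^-1 * (-1 - 1).
Proof.
by rewrite chiZ ?N1_neq0 // chiB ?N1_neq0 // chi1 ?N1_neq0 // chi_dgen ?N1_neq0.
Qed.

End Counterexample.

Theorem mainTheorem6 (n : nat) (n_ge2 : (2 <= n)%N) :
  [set Phi u | u in @Dint n] `<=` @Dhat n Zv `&` range (@Phi n) /\
  [set Phi u | u in @Dint n] <> @Dhat n Zv `&` range (@Phi n).
Proof.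
split=> [_ [x xD <-]|E]; first by split; [exact: Dint_Dhat|exists x].
have : (@Dhat n Zv `&` range (@Phi n)) (Phi (Kquot n)).
  by split; [exact: Dhat_Kquot|exists (Kquot n)].
(* Equality of the two sets yields only some x in D with the same image as [Kquot n]; the characters
   take equal values on both. *)
rewrite -E => -[x xD xK].
apply: not_Zv_witness; rewrite -(chi_Kquot n_ge2).
by rewrite -(chi_Phi_inj n_ge2 xK N1_neq0); exact: Zv_chi_Dint.
Qed.
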